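(* Assume (A1)--(A5) and (A7) of the context. Let $\tau>0$ and let $\bar\omega_t\colon X\to X$, $t\in[0,T]$, be a transition rule of the BDF2 discretization, i.e. for each $x\in X$, $t\in[0,T]$ there is a sequence $(u_s)_{s\in\mathbb N}$ in $X$ with $u_0=x$ and, setting $u_{-1}=x$, $u_{s+1}\in\arg\min_{y\in X}\{E_t(y)+\frac1\tau d(y,u_s)^2-\frac1{4\tau}d(y,u_{s-1})^2\}$ for all $s\in\mathbb N$, having $\bar\omega_t(x)$ as a cluster point. Let $E^B_{t,\tau}(x,x'):=\inf_{y\in X}\{E_t(y)+\frac1\tau d(y,x)^2-\frac1{4\tau}d(y,x')^2\}$ and $$c^B_t(x_1,x_2):=\inf\sum_{s=a}^{b+1}\Big(E_t(u_s)-E^B_{t,\tau}(u_s,u_{s-1})+\tfrac1{2\tau}d(u_{s+1},u_s)^2+\tfrac1{2\tau}d(u_s,u_{s-1})^2-\tfrac1{4\tau}d(u_{s+1},u_{s-1})^2\Big),$$ the infimum being over all integers $a\le b$ and $u_a,\dots,u_b\in X$ with $u_a=x_1$, $u_b=x_2$, where $u_{a-1}:=x_1$, $u_{b+1}:=u_{b+2}:=x_2$. Then the transition rule is compatible with the action $c^B_t$. Moreover, for every $\tau\le\frac1L$ ($L$ the Lipschitz constant in (A7)), the map $c^B_t\colon X\times X\to[0,\infty)$ is an action generated by curves, with $\mathbb I=\mathbb Z$ and the following data: $\mathscr P^B:=X\times X\times X$, with points written $\underline x=(x_{-1},x_0,x_1)$ and $d_{\mathscr P^B}(\underline x,\underline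 x')=\frac13\sum_{i=-1}^1d(x_i,x_i')$; $i^B(x):=(x,x,x)$; $\Gamma(\underline x,\underline x')$ is the set of all $\gamma=(\gamma_{-1},\gamma_0,\gamma_1)\colon[a,b]_{\mathbb Z}\to\mathscr P^B$, $a<b\in\mathbb Z$, with $\gamma(a)=\underline x$, $\gamma(b)=\underline x'$ and $\gamma_1(s)=\gamma_0(s+1)$, $\gamma_0(s)=\gamma_{-1}(s+1)$ for all $s\in[a,b-1]_{\mathbb Z}$; $$\mathcal L^B_t(\underline x):=E_t(x_0)-E^B_{t,\tau}(x_0,x_{-1})+\tfrac1{2\tau}\big(d(x_0,x_1)^2+d(x_{-1},x_0)^2\big)-\tfrac1{4\tau}d(x_{-1},x_1)^2;$$ and $\mathfrak c^B_t(\underline x,\underline x'):=\inf_{\gamma\in\Gamma(\underline x,\underline x')}\sum_{s=a+1}^b\mathcal L^B_t(\gamma(s))$.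
   Context: Setting: $T>0$; $(X,d)$ is a metric space; $E\colon[0,T]\times X\to\mathbb R$, written $E_t(x)$. Slope: $|\partial E_t|(x)=\limsup_{x'\to x}\frac{(E_t(x)-E_t(x'))^+}{d(x,x')}$. $\mathrm{Crit}_t=\{x\in X:|\partial E_t|(x)=0\}$. (A1) $(X,d)$ is locally compact. (A2) $E$ is continuous; it is differentiable in $t$ with $\partial_tE$ continuous on $[0,T]\times X$; and $(t,x)\mapsto|\partial E_t|(x)$ is real-valued and continuous on $[0,T]\times X$. (A3) There are $C_1,C_2>0$ with $|\partial_tE_t(x)|\le C_1E_t(x)+C_2$ for all $(t,x)$. (A4) With $G(x)=\sup_{t\in[0,T]}|E_t(x)|$, the set $\{G\le C\}$ is compact for every $C\in\mathbb R$. (A5) For every $t$, $\mathrm{Crit}_t$ is a disjoint union of well-separated compact sets (each has positive distance from the union of the others), each of them path-connected by rectifiable paths; moreover $E_t$ is constant on every path-connected component of $\mathrm{Crit}_t$. (A7) $(X,d)$ is a path space: $d(x,x')=\inf\{\int_0^1|\dot\eta(s)|ds:\eta\in AC([0,1],X),\eta(0)=x,\eta(1)=x'\}$ ($|\dot\eta|$ the metric derivative); and there is $L>0$ with $\big||\partial E_t|(x)-|\partial E_t|(x')\big|\le L\,d(x,x')$ for all $t,x,x'$. Action: a family $(c_t)_{t\in[0,T]}$ of lower semicontinuous functions $c_t\colon X\times X\to[0,\infty)$ with $E_t(x)-E_t(x')\le c_t(x,x')$ for all $x,x',t$. A family of maps $\bar\omega_t\colon X\to X$ (transition rule) is compatible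 with the action if $E_t(x)-E_t(\bar\omega_t(x))=c_t(x,\bar\omega_t(x))$ for all $x,t$. Actions generated by curves: for $\mathbb I\in\{\mathbb Z,\mathbb R\}$ write $[a,b]_{\mathbb I}=[a,b]\cap\mathbb I$, $(a,b]_{\mathbb I}=(a,b]\cap\mathbb I$. An action $c_t$ is generated by curves if there are $\mathbb I\in\{\mathbb Z,\mathbb R\}$, a metric space $(\mathscr P,d_{\mathscr P})$, a map $\Gamma$ assigning to $(p_1,p_2)\in\mathscr P^2$ a set $\Gamma(p_1,p_2)$ of curves $\gamma\colon[a,b]_{\mathbb I}\to\mathscr P$ ($a<b$ in $\mathbb I$ depending on $\gamma$) with $\gamma(a)=p_1,\gamma(b)=p_2$, a closed immersion $i\colon X\to\mathscr P$ (homeomorphism onto a closed subset) and a continuous $\mathcal L\colon\mathscr P\times[0,T]\to[0,\infty)$, $(p,t)\mapsto\mathcal L_t(p)$, with $c_t(x_1,x_2)=\mathfrak c_t(i(x_1),i(x_2))$, $\mathfrak c_t(p_1,p_2):=\inf_{\gamma\in\Gamma(p_1,p_2)}\int_{(a,b]_{\mathbb I}}\mathcal L_t(\gamma(s))\,d\nu(s)$ ($\nu$ Lebesgue measure if $\mathbb I=\mathbb R$, counting measure if $\mathbb I=\mathbb Z$), such that for every $t\in[0,T]$: (P1) restrictions to subintervals, concatenations and shifts of admissible curves are admissible: if $\gamma\in\Gamma(p_1,p_3)$ has domain $[a,b]_{\mathbb I}$ and $\gamma(s)=p_2$ with $a<s<b$, then $\gamma|_{[a,s]_{\mathbb I}}\in\Gamma(p_1,p_2)$,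 $\gamma|_{[s,b]_{\mathbb I}}\in\Gamma(p_2,p_3)$; if $\gamma\in\Gamma(p_1,p_2)$, $\gamma'\in\Gamma(p_2,p_3)$ have domains $[a,s]_{\mathbb I}$, $[s,b]_{\mathbb I}$, the curve equal to $\gamma$ on $[a,s]_{\mathbb I}$ and to $\gamma'$ on $(s,b]_{\mathbb I}$ is in $\Gamma(p_1,p_3)$; if $\gamma\in\Gamma(p_1,p_2)$ and $r\in\mathbb I$ then $\gamma(\cdot+r)\in\Gamma(p_1,p_2)$. (P2) $\mathcal L_t(p)=0$ iff $p=i(x)$ for some $x$ with $|\partial E_t|(x)=0$. (P3) For $x_1\ne x_2$, $c_t(x_1,x_2)=0$ iff $i(x_1),i(x_2)$ lie in the same connected component of $\{p:\mathcal L_t(p)=0\}$. (P4) For every compact $K\subset\mathscr P$ there is a compact $K'\subset\mathscr P$ (independent of $t$) such that for all $p_1,p_2\in K$ and $\varepsilon>0$ there is $\gamma\in\Gamma(p_1,p_2)$ with image in $K'$ and $\int_{(a,b]_{\mathbb I}}\mathcal L_t(\gamma(s))d\nu(s)\le\mathfrak c_t(p_1,p_2)+\varepsilon$. (P5) For every compact $K\subset\mathscr P$ and $\varepsilon>0$ there are $L',P>0$ such that $\mathfrak c_t(p_1,p_2)\le\varepsilon$ for all $p_1,p_2\in K$ with $\mathcal L_t(p_1)\le P$, $\mathcal L_t(p_2)\le P$, $d_{\mathscr P}(p_1,p_2)\le L'$.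
   Formalization: The identity of c^B_t(x_1,x_2) with the curve infimum between i^B(x_1) and i^B(x_2) is asserted only when x_1≠x_2 or x_1 is critical; at x_1=x_2=x not critical it is false, since c^B_t(x,x) is at least 2L^B_t(x,x,x)>0 while a two-point constant curve costs L^B_t(x,x,x). *)

(* Defs.v *)
(* MathComp-Analysis *)
From HB Require Import structures.
From mathcomp Require Import all_boot all_order all_algebra.
From mathcomp Require Import all_classical all_reals all_analysis.
From mathcomp Require Import ring lra.

Set Implicit Arguments.
Unset Strict Implicit.
Unset Printing Implicit Defensive.

Import Order.TTheory GRing.Theory Num.Theory.
Import numFieldNormedType.Exports.

Local Open Scope classical_set_scope.
Local Open Scope ring_scope.

(* Functions of (t, x) in [0, T] * X are represented by total functions
   R -> X -> R; only their values at times in [0, T] are ever used. *)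

Section Energy.
Context {R : realType} {X : metricType R}.
Implicit Types (T t : R) (E : R -> X -> R).

Definition time_space T : set (R * X) := [set p | 0 <= p.1 <= T].

(* The maximum with 0 only matters at isolated points, where the limsup over
   the punctured neighbourhoods is -oo and the slope is 0 by convention. *)
Definition slope E t (x : X) : \bar R :=
  maxe 0%E (limf_esup
    (fun x' : X => (Num.max (E t x - E t x') 0 / mdist x x')%:E) x^').

Definition Crit E t : set X := [set x | slope E t x = 0%E].

(* One-sided at t = 0 and t = T. *)
Definition time_quotient E t x (s : R) : R := (E s x - E t x) / (s - t).

Definition time_derivative E T t x : R :=
  lim (time_quotient E t x s @[s --> within `[0, T] t^']).

Record regular_energy E T : Prop := {
  energy_continuous :
    {within time_space T, continuous (fun p : R * X => E p.1 p.2)} ;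
  energy_derivable : forall t x, 0 <= t <= T ->
    cvg (time_quotient E t x s @[s --> within `[0, T] t^']) ;
  energy_derivative_continuous :
    {within time_space T,
      continuous (fun p : R * X => time_derivative E T p.1 p.2)} ;
  slope_finite : forall t x, 0 <= t <= T -> slope E t x \is a fin_num ;
  slope_continuous :
    {within time_space T,
      continuous (fun p : R * X => fine (slope E p.1 p.2))} }.

Definition power_control E T : Prop :=
  exists C1 C2 : R, [/\ 0 < C1, 0 < C2 & forall t x, 0 <= t <= T ->
    `|time_derivative E T t x| <= C1 * E t x + C2].

Definition energy_sup E T (x : X) : \bar R :=
  ereal_sup [set `|E t x|%:E | t in [set t | 0 <= t <= T]].

Definition compact_sublevels E T : Prop :=
  forall C : R, compact [set x | (energy_sup E T x <= C%:E)%E].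

Definition path_in (A : set X) (x y : X) (eta : R -> X) : Prop :=
  [/\ {within `[0, 1], continuous eta}, eta 0 = x, eta 1 = y
    & forall s, 0 <= s <= 1 -> A (eta s)].

Definition rectifiable (eta : R -> X) : Prop :=
  exists M : R, forall s : seq R, itv_partition 0 1 s ->
    let F := eta \o nth 1 (0 :: s) in
    \sum_(0 <= n < size s) mdist (F n) (F n.+1) <= M.

Definition separated_critical_sets E T : Prop :=
  forall t, 0 <= t <= T ->
  (exists F : set (set X),
    [/\ Crit E t = \bigcup_(K in F) K,
        trivIset F id,
        forall K, F K -> compact K,
        forall K, F K -> exists2 r : R, 0 < r &
          forall K' x y, F K' -> K' <> K -> K x -> K' y -> r <= mdist x y
      & forall K, F K -> forall x y, K x -> K y ->
          exists2 eta, path_in K x y eta & rectifiable eta])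
  /\ (forall x y, (exists eta, path_in (Crit E t) x y eta) -> E t x = E t y).

Definition AC01 (eta : R -> X) : Prop :=
  exists2 g : R -> R,
    (@lebesgue_measure R).-integrable `[0, 1] (EFin \o g) &
    forall s r, 0 <= s -> s <= r -> r <= 1 ->
      ((mdist (eta s) (eta r))%:E
        <= \int[@lebesgue_measure R]_(z in `[s, r]) (g z)%:E)%E.

(* For eta in AC01 the limit exists at almost every s; the limsup makes the
   metric derivative total. *)
Definition metric_derivative (eta : R -> X) (s : R) : \bar R :=
  limf_esup (fun r : R => (mdist (eta r) (eta s) / `|r - s|)%:E) s^'.

Definition slope_lipschitz E T (L : R) : Prop :=
  forall t x x', 0 <= t <= T ->
    `|fine (slope E t x) - fine (slope E t x')| <= L * mdist x x'.

Definition is_action E T (c : R -> X -> X -> R) : Prop :=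
  forall t, 0 <= t <= T ->
    [/\ forall x x', 0 <= c t x x',
        lower_semicontinuous (fun p : X * X => (c t p.1 p.2)%:E)
      & forall x x', E t x - E t x' <= c t x x'].

Definition compatible E T (c : R -> X -> X -> R) (omega : R -> X -> X) : Prop :=
  forall t x, 0 <= t <= T -> E t x - E t (omega t x) = c t x (omega t x).

End Energy.

Definition path_space (R : realType) (X : metricType R) : Prop :=
  forall x x' : X,
    (mdist x x')%:E = ereal_inf
      [set (\int[@lebesgue_measure R]_(s in `[0%R, 1%R])
              metric_derivative eta s)%E
        | eta in [set eta : R -> X | [/\ AC01 eta, eta 0 = x & eta 1 = x']]].

(* The sum of f over the integers s with a < s <= b, for a <= b. *)
Definition int_sum (R : realType) (f : int -> R) (a b : int) : R :=
  \sum_(k < `|b - a|%N) f (a + k.+1%:Z).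

Inductive index_kind := Zindex | Rindex.

Definition index (R : realType) (I : index_kind) : realDomainType :=
  match I with Zindex => int | Rindex => R end.

Definition curve_cost (R : realType) (I : index_kind) :
    (index R I -> R) -> index R I -> index R I -> \bar R :=
  match I return (index R I -> R) -> index R I -> index R I -> \bar R with
  | Zindex => fun f a b => (int_sum f a b)%:E
  | Rindex => fun f a b =>
      (\int[@lebesgue_measure R]_(s in `]a, b]) (f s)%:E)%E
  end.

Section GeneratedByCurves.
Context {R : realType} {X : metricType R}.
Variables (E : R -> X -> R) (T : R) (c : R -> X -> X -> R).
(* The triples (t, x1, x2) at which c t x1 x2 has to be the infimum of the curve
   costs: all of them in the notion proper. *)
Variable D : R -> X -> X -> Prop.
Variables (I : index_kind) (P : metricType R).
(* Gamma p1 p2 a b gamma: the restriction of gamma to [a, b] is an admissible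
   curve from p1 to p2. *)
Variable Gamma :
  P -> P -> index R I -> index R I -> (index R I -> P) -> Prop.
Variables (i : X -> P) (Lag : R -> P -> R).

Definition curve_action (t : R) (p1 p2 : P) : \bar R :=
  ereal_inf [set z | exists a b gamma,
    Gamma p1 p2 a b gamma /\ z = curve_cost (Lag t \o gamma) a b].

Record closed_immersion : Prop := {
  immersion_injective : injective i ;
  immersion_continuous : continuous i ;
  immersion_open : forall U : set X, open U ->
    exists2 V : set P, open V & i @` U = V `&` range i ;
  immersion_closed : closed (range i) }.

Record admissible_curves : Prop := {
  (* Membership depends only on the values on [a, b]. *)
  curves_ext : forall p1 p2 a b gamma gamma', Gamma p1 p2 a b gamma ->
    (forall s, a <= s <= b -> gamma s = gamma' s) ->
    Gamma p1 p2 a b gamma' ;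
  curves_ends : forall p1 p2 a b gamma, Gamma p1 p2 a b gamma ->
    [/\ a < b, gamma a = p1 & gamma b = p2] ;
  curves_restr : forall p1 p2 p3 a s b gamma, Gamma p1 p3 a b gamma ->
    a < s < b -> gamma s = p2 ->
    Gamma p1 p2 a s gamma /\ Gamma p2 p3 s b gamma ;
  curves_concat : forall p1 p2 p3 a s b gamma gamma',
    Gamma p1 p2 a s gamma -> Gamma p2 p3 s b gamma' ->
    Gamma p1 p3 a b (fun r => if r <= s then gamma r else gamma' r) ;
  curves_shift : forall p1 p2 a b r gamma, Gamma p1 p2 a b gamma ->
    Gamma p1 p2 (a - r) (b - r) (fun s => gamma (s + r)) }.

Record generated_by_curves_on : Prop := {
  generated_action : is_action E T c ;
  generated_immersion : closed_immersion ;
  generated_lag_ge0 : forall t p, 0 <= t <= T -> 0 <= Lag t p ;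
  generated_lag_continuous :
    {within [set q : P * R | 0 <= q.2 <= T],
      continuous (fun q : P * R => Lag q.2 q.1)} ;
  generated_representation : forall t x1 x2, 0 <= t <= T -> D t x1 x2 ->
    (c t x1 x2)%:E = curve_action t (i x1) (i x2) ;
  generated_curves : admissible_curves ;
  generated_zeros : forall t p, 0 <= t <= T ->
    (Lag t p = 0 <-> exists2 x, p = i x & slope E t x = 0%E) ;
  generated_components : forall t x1 x2, 0 <= t <= T -> x1 <> x2 ->
    (c t x1 x2 = 0 <->
     connected_component [set p | Lag t p = 0] (i x1) (i x2)) ;
  generated_compactness : forall K : set P, compact K ->
    exists2 K' : set P, compact K' &
      forall t p1 p2 (e : R), 0 <= t <= T -> K p1 -> K p2 -> 0 < e ->
        exists a b gamma,
          [/\ Gamma p1 p2 a b gamma,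
              forall s, a <= s <= b -> K' (gamma s)
            & (curve_cost (Lag t \o gamma) a b
                <= curve_action t p1 p2 + e%:E)%E] ;
  generated_local_control : forall t, 0 <= t <= T ->
    forall (K : set P) (e : R), compact K -> 0 < e ->
      exists L' Pm : R, [/\ 0 < L', 0 < Pm
        & forall p1 p2, K p1 -> K p2 -> Lag t p1 <= Pm -> Lag t p2 <= Pm ->
            mdist p1 p2 <= L' -> (curve_action t p1 p2 <= e%:E)%E] }.

End GeneratedByCurves.

(* X * X * X with the averaged distance. The alias keeps it apart from the
   product (max-distance) structure of the library on X * X * X. *)
Definition triple (X : Type) : Type := (X * X * X)%type.

Definition mk3 (X : Type) (x y z : X) : triple X := (x, y, z).
Definition comp_m1 (X : Type) (p : triple X) : X := p.1.1.
Definition comp_0 (X : Type) (p : triple X) : X := p.1.2.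
Definition comp_p1 (X : Type) (p : triple X) : X := p.2.

Section TripleMetric.
Context {R : realType} {X : metricType R}.
Implicit Types p q r : triple X.

Definition triple_dist p q : R :=
  3^-1 * (mdist (comp_m1 p) (comp_m1 q) + mdist (comp_0 p) (comp_0 q) + mdist (comp_p1 p) (comp_p1 q)).

Let triple_distxx p : triple_dist p p = 0.
Proof. by rewrite /triple_dist !mdistxx !addr0 mulr0. Qed.

Let triple_dist_positivity p q : triple_dist p q = 0 -> p = q.
Proof.
rewrite /triple_dist => h.
have h1 := @mdist_ge0 _ _ (comp_m1 p) (comp_m1 q).
have h2 := @mdist_ge0 _ _ (comp_0 p) (comp_0 q).
have h3 := @mdist_ge0 _ _ (comp_p1 p) (comp_p1 q).
have e1 : comp_m1 p = comp_m1 q by apply: mdist_positivity; lra.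
have e2 : comp_0 p = comp_0 q by apply: mdist_positivity; lra.
have e3 : comp_p1 p = comp_p1 q by apply: mdist_positivity; lra.
by case: p q e1 e2 e3 {h h1 h2 h3} => [[? ?] ?] [[? ?] ?];
  rewrite /comp_m1 /comp_0 /comp_p1 /= => -> -> ->.
Qed.

Let triple_dist_sym p q : triple_dist p q = triple_dist q p.
Proof.
by rewrite /triple_dist (metric_sym (comp_m1 p)) (metric_sym (comp_0 p))
  (metric_sym (comp_p1 p)).
Qed.

Let triple_dist_triangle q p r :
  triple_dist p r <= triple_dist p q + triple_dist q r.
Proof.
rewrite /triple_dist.
have := metric_triangle (comp_m1 p) (comp_m1 q) (comp_m1 r).
have := metric_triangle (comp_0 p) (comp_0 q) (comp_0 r).
have := metric_triangle (comp_p1 p) (comp_p1 q) (comp_p1 r).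
lra.
Qed.

HB.instance Definition _ := Choice.copy (triple X) (X * X * X)%type.
HB.instance Definition _ := @isMetric.Build R (triple X) triple_dist
  triple_distxx triple_dist_positivity triple_dist_sym triple_dist_triangle.

End TripleMetric.

Section BDF2.
Context {R : realType} {X : metricType R}.
Variables (E : R -> X -> R) (tau : R).

Definition bdf2_functional (t : R) (x x' y : X) : R :=
  E t y + tau^-1 * mdist y x ^+ 2 - (4 * tau)^-1 * mdist y x' ^+ 2.

(* E^B_{t,tau}(x, x'): a genuine infimum when E t is bounded below. *)
Definition bdf2_energy (t : R) (x x' : X) : R :=
  inf (range (bdf2_functional t x x')).

(* At s = 0 the predecessor u_{-1} is u_0 = x. *)
Definition bdf2_sequence (t : R) (x : X) (u : nat -> X) : Prop :=
  u 0%N = x /\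
  forall (s : nat) (y : X),
    bdf2_functional t (u s) (u s.-1) (u s.+1)
      <= bdf2_functional t (u s) (u s.-1) y.

Definition bdf2_transition_rule (T : R) (omega : R -> X -> X) : Prop :=
  forall t x, 0 <= t <= T ->
    exists2 u : nat -> X, bdf2_sequence t x u & cluster (u @ \oo) (omega t x).

Definition bdf2_chain_cost (t : R) (u : int -> X) (a b : int) : R :=
  int_sum (fun s : int =>
    E t (u s) - bdf2_energy t (u s) (u (s - 1))
    + (2 * tau)^-1 * mdist (u (s + 1)) (u s) ^+ 2
    + (2 * tau)^-1 * mdist (u s) (u (s - 1)) ^+ 2
    - (4 * tau)^-1 * mdist (u (s + 1)) (u (s - 1)) ^+ 2) (a - 1) (b + 1).

(* For 0 < tau <= L^-1 (with E t bounded below) this is the curve action between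
   (x1, x1, x1) and (x2, x2, x2), except when x1 = x2 = x is not critical. There
   the two definitions differ: every chain has at least two terms that are at
   least the Lagrangian at (x, x, x), at s = a and s = b + 1, so that
   bdf2_action t x x is twice that value (attained by a = b), whereas a curve
   with b = a + 1 and gamma a = gamma b = (x, x, x) costs it only once. *)
Definition bdf2_action (t : R) (x1 x2 : X) : R :=
  inf [set z | exists a b (u : int -> X),
    [/\ a <= b, u a = x1 /\ u b = x2,
        [/\ u (a - 1) = x1, u (b + 1) = x2 & u (b + 2) = x2]
      & z = bdf2_chain_cost t u a b]].

Definition bdf2_immersion (x : X) : triple X := mk3 x x x.

Definition bdf2_curves (p q : triple X) (a b : index R Zindex)
    (gamma : index R Zindex -> triple X) : Prop :=
  [/\ a < b, gamma a = p, gamma b = q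
    & forall s, a <= s <= b - 1 ->
        comp_p1 (gamma s) = comp_0 (gamma (s + 1)) /\
        comp_0 (gamma s) = comp_m1 (gamma (s + 1))].

Definition bdf2_lagrangian (t : R) (p : triple X) : R :=
  E t (comp_0 p) - bdf2_energy t (comp_0 p) (comp_m1 p)
  + (2 * tau)^-1 * (mdist (comp_0 p) (comp_p1 p) ^+ 2 + mdist (comp_m1 p) (comp_0 p) ^+ 2)
  - (4 * tau)^-1 * mdist (comp_m1 p) (comp_p1 p) ^+ 2.

End BDF2.

(* Main.v *)
(* With a = d(x_{-1}, x_0) and b = d(x_0, x_1), testing the infimum E^B with x_0
   bounds the Lagrangian below by (a^2 + (a - b)^2) / (4 tau), and testing it with
   x_1 gives E(x_0) - E(x_1) <= Lag + (b^2 - a^2) / (2 tau), with equality when x_1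
   is a minimizer. The quadratic terms telescope along a chain, which yields both
   the action inequality and, along a BDF2 sequence, its equality case.

   For tau <= 1 / L the zeros of the Lagrangian are the critical points, because
   in a path space a critical point x satisfies E(x) - E(y) <= (L / 2) d(x, y)^2:
   along an almost shortest curve the slope is at most L times the arc length.
   The same bound makes the cost of a step of a chain of critical points quadratic
   in its length, so the cost of fine chains along a rectifiable critical path
   vanishes. Conversely a chain of small cost has small jumps and cannot leave a
   neighbourhood of a critical component: it would accumulate, in a compact
   sublevel set, at a critical point outside that component. *)

Require Import Defs.
From HB Require Import structures.
From mathcomp Require Import all_boot all_order all_algebra.
From mathcomp Require Import all_classical all_reals all_analysis.
From mathcomp Require Import measurable_realfun zify ring lra.

Set Implicit Arguments.
Unset Strict Implicit.
Unset Printing Implicit Defensive.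

Import Order.TTheory GRing.Theory Num.Theory.
Import numFieldNormedType.Exports.

Local Open Scope classical_set_scope.
Local Open Scope ring_scope.

(** * The length of an absolutely continuous curve *)

(** Two obstacles shape the development. The infimum in a path space integrates the metric
    derivative, which need not be measurable a priori; a measurable minorant of it still recovers
    distances and supplies the arc length behind the quadratic growth. And E^B is an infimum over
    all of X, so the Lagrangian does not simply inherit the continuity of E. What helps is the half
    of the penalty that survives the subtracted term: it confines near-minimizers to bounded
    distance and bounded energy. The resulting modulus is uniform over all triples with bounded
    energy and jumps, and this uniformity allows the ends of a chain to be moved at a price
    independent of its length, whence the lower semicontinuity of the action. Uniformity in time
    comes from (A3): with [K0 = C2 / C1] it gives [0 <= E t x + K0] and a two-sided Gronwall bound,
    by which estimates at one time serve all times, as (P4) demands. *)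

Lemma continuous_primitive (R : realType) (H : R -> R) (a b : R) :
  continuous H ->
  exists Phi : R -> R, forall x, a < x < b -> is_derive x 1 Phi (H x).
Proof.
move=> cH; exists (fun x => (\int[@lebesgue_measure R]_(t in `[a, x]) H t)%R).
move=> x /andP[ax xb].
have iH : (@lebesgue_measure R).-integrable `[a, b] (EFin \o H).
  apply: continuous_compact_integrable; first exact: segment_compact.
  exact: continuous_subspaceT.
have [dF F'] := continuous_FTC1_closed xb iH ax (cH x).
by apply: DeriveDef; [exact: dF|rewrite -derive1E; exact: F'].
Qed.

(** With a primitive [Phi] of [H], the integrand is the derivative of [Phi (u + h) - Phi u]. The
    integral is thus a difference of two integrals of [H] over windows of length h, at r and at s,
    and the mean value theorem with monotonicity bounds each of them. *)
Lemma integral_increment_le (R : realType) (H : R -> R) (s r h : R) :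
  continuous H -> {homo H : x y / x <= y} -> s < r -> 0 < h ->
  (\int[@lebesgue_measure R]_(u in `[s, r]) (H (u + h) - H u)%:E
    <= (h * (H (r + h) - H s))%:E)%E.
Proof.
move=> cH mH sr h0.
have [Phi dPhi] := @continuous_primitive R H (s - 1) (r + h + 1) cH.
pose G u := Phi (u + h) - Phi u.
have dG (u : R) : s - 1 < u < r + 1 -> is_derive u 1 G (H (u + h) - H u).
  move=> /andP[su ur].
  apply: is_deriveB; last by apply: dPhi; lra.
  have := @is_derive1_comp R Phi (shift h) u (H (u + h)) 1.
  rewrite mulr1; apply.
  - by apply: dPhi => /=; lra.
  - rewrite -[X in is_derive _ _ _ X](addr0 1).
    by apply: is_deriveD.
have dcG (u : R) : s - 1 < u < r + 1 -> {for u, continuous G}.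
  move=> /dG uG; apply/differentiable_continuous/derivable1_diffP.
  exact: ex_derive.
have cinc : continuous (fun u => H (u + h) - H u).
  move=> u; apply: cvgB; last exact: cH.
  apply: (@continuous_comp _ _ _ (fun u => u + h) H u); last exact: cH.
  by apply: cvgD; [exact: cvg_id|exact: cvg_cst].
rewrite (@continuous_FTC2 R _ G s r) //; last 3 first.
- exact: continuous_subspaceT.
- split.
  + move=> u; rewrite in_itv/= => /andP[su ur]; apply: ex_derive.
    apply: dG; lra.
  + apply: cvg_at_right_filter; apply: (dcG s).
    by apply/andP; split; lra.
  + apply: cvg_at_left_filter; apply: (dcG r).
    by apply/andP; split; lra.
- move=> u; rewrite in_itv/= => /andP[su ur].
  rewrite derive1E; apply: derive_val.
  apply: dG; lra.
rewrite -EFinB lee_fin.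
have mvt x : s <= x <= r -> exists2 c, x <= c <= x + h & G x = h * H c.
  move=> /andP[sx xr].
  have xxh : x < x + h by rewrite ltrDl.
  have [||c] := @MVT R Phi H x (x + h) xxh.
  - by move=> z; rewrite in_itv/= => /andP[? ?]; apply: dPhi; lra.
  - apply: derivable_within_continuous => z.
    rewrite in_itv/= => /andP[? ?]; apply: (@ex_derive _ _ _ _ _ _ (H z)).
    apply: dPhi; lra.
  rewrite in_itv/= => /andP[? ?] e; exists c; first lra.
  by rewrite /G e; ring.
have [c1 c1i ->] := mvt r ltac:(lra).
have [c2 c2i ->] := mvt s ltac:(lra).
rewrite -mulrBr ler_pM2l// lerB//; apply: mH; lra.
Qed.

Lemma limf_esup_lt (T : choiceType) (X : filteredType T) (R : realType)
    (F : set (set X))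
    (f : X -> \bar R) (l : \bar R) :
  (limf_esup f F < l)%E -> exists2 V, F V & forall x, V x -> (f x < l)%E.
Proof.
move=> /ereal_inf_lt[_ [V FV <-] Vl]; exists V => // x Vx.
by apply: le_lt_trans Vl; apply: ereal_sup_ubound; exists x.
Qed.

Lemma limf_esup_le (T : choiceType) (X : filteredType T) (R : realType)
    (F : set (set X))
    (f : X -> \bar R) (l : \bar R) (V : set X) :
  F V -> (forall x, V x -> (f x <= l)%E) -> (limf_esup f F <= l)%E.
Proof.
move=> FV Vl; apply: (@le_trans _ _ (ereal_sup (f @` V))).
  by apply: ereal_inf_lbound; exists V.
by apply: ge_ereal_sup => _ [x Vx <-]; exact: Vl.
Qed.

Lemma limn_einf_ge (R : realType) (f : nat -> \bar R) (l : \bar R) (N : nat) :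
  (forall n, (N <= n)%N -> (l <= f n)%E) -> (l <= limn_einf f)%E.
Proof.
move=> Nl; rewrite /limn_einf leeNr; apply: (@limf_esup_le _ _ _ _ _ _ [set n | (N <= n)%N]).
  by exists N.
by move=> n /= /Nl; rewrite leeN2.
Qed.

(** Precomposing with this projection turns a curve controlled only on [0, 1] into one that is
    continuous on the whole line, so that increments reaching beyond 1 keep a meaning. *)
Definition clamp01 (R : realType) (u : R) : R := Num.max 0 (Num.min 1 u).

Lemma clamp01_itv (R : realType) (u : R) : 0 <= clamp01 u <= 1.
Proof. by rewrite /clamp01 le_max lexx /= ge_max ler01 ge_min lexx. Qed.

Lemma clamp01_id (R : realType) (u : R) : 0 <= u <= 1 -> clamp01 u = u.
Proof. by move=> /andP[u0 u1]; rewrite /clamp01 (min_r u1) (max_r u0). Qed.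

Lemma clamp01_mono (R : realType) : {homo @clamp01 R : u v / u <= v}.
Proof.
by move=> u v uv; rewrite /clamp01 /Num.max /Num.min; repeat case: ifP => //; lra.
Qed.

Lemma clamp01_lip (R : realType) (u v : R) :
  `|clamp01 u - clamp01 v| <= `|u - v|.
Proof.
wlog uv : u v / u <= v.
  by move=> W; have [/W//|/ltW/W] := leP u v; rewrite distrC (distrC v).
have cuv := clamp01_mono uv.
rewrite !(distrC _ v) (distrC _ (clamp01 v)) !ger0_norm ?subr_ge0//.
by move: uv; rewrite /clamp01 /Num.max /Num.min; repeat case: ifP => //; lra.
Qed.

Lemma clamp01_continuous (R : realType) : continuous (@clamp01 R).
Proof.
move=> u; apply/cvgrPdist_lt => e e0; near=> v.
apply: le_lt_trans (clamp01_lip _ _) _.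
by near: v; apply: cvgr_dist_lt.
Unshelve. all: by end_near. Qed.

Section CurveSpeed.
Context {R : realType} {X : metricType R}.
Variable eta : R -> X.
Notation mu := (@lebesgue_measure R).

Let etac (u : R) : X := eta (clamp01 u).

Definition difference_quotient (n : nat) (u : R) : \bar R :=
  (n.+1%:R * mdist (etac (u + harmonic n)) (etac u))%:E.

(* A measurable minorant of the metric derivative: only the increments 1/(n+1)
   are used. *)
Definition curve_speed (u : R) : \bar R :=
  limn_esup (difference_quotient ^~ u).

Lemma difference_quotient_ge0 n u : (0 <= difference_quotient n u)%E.
Proof. by rewrite lee_fin mulr_ge0 ?mdist_ge0. Qed.

Lemma curve_speed_ge0 u : (0 <= curve_speed u)%E.
Proof.
apply: limf_esup_ge0 => [[N _ /(_ N) /= h]|n].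
  exact: h.
exact: difference_quotient_ge0.
Qed.

Lemma curve_speed_le_metric_derivative u : 0 <= u <= 1 ->
  (curve_speed u <= metric_derivative eta u)%E.
Proof.
(* At the right end the clamp makes every forward increment zero, so the speed is at most 0
   there. *)
move=> /andP[u0]; rewrite le_eqVlt => /orP[/eqP ->|u1].
  apply: (@le_trans _ _ 0%E).
    apply: (@limf_esup_le _ _ _ _ _ _ setT); first exact: filterT.
    move=> n _; rewrite /difference_quotient /etac.
    suff -> : clamp01 (1 + harmonic n) = clamp01 1 :> R by rewrite mdistxx mulr0.
    by rewrite /clamp01 !min_l// lerDl harmonic_ge0.
  apply: limf_esup_ge0 => [|v]; last by rewrite lee_fin divr_ge0 ?mdist_ge0.
  exact: (@filter_not_empty _ _ (Proper_dnbhs_numFieldType _)).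
apply: le_ereal_inf_tmp => _ [A uA <-].
move: uA => /(@nbhs_ballP R R^o)[e /= e0 eA].
have e1 : 0 < Num.min e (1 - u) by rewrite lt_min e0 subr_gt0.
have [N _ hN] := cvgr0_norm_lt _ (@cvg_harmonic R) _ e1.
apply: (@limf_esup_le _ _ _ _ _ _ [set n | (N <= n)%N]); first by exists N.
move=> n /= Nn; have := hN n Nn.
have h0 : 0 < (harmonic n : R) by exact: harmonic_gt0.
rewrite gtr0_norm// lt_min => /andP[he hu].
apply: ereal_sup_ubound; exists (u + harmonic n) => /=.
  apply: eA; last by rewrite gt_eqF// ltrDl.
  by rewrite /ball/= opprD addNKr normrN gtr0_norm.
have cu : clamp01 u = u by apply: clamp01_id; lra.
have cuh : clamp01 (u + harmonic n) = u + harmonic n by apply: clamp01_id; lra.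
rewrite /difference_quotient /etac cu cuh.
have -> : u + harmonic n - u = harmonic n :> R by rewrite addrC addKr.
by rewrite gtr0_norm// /harmonic/= invrK mulrC.
Qed.

End CurveSpeed.

Lemma difference_quotient_cvg (R : realType) (F : R -> R) (x l : R) :
  derivable F x 1 -> derive1 F x = l ->
  n.+1%:R * (F (x + harmonic n) - F x) @[n --> \oo] --> l.
Proof.
move=> dF Fl.
have : h^-1 *: (F (h *: 1 + x) - F x) @[h --> 0^'] --> l.
  by rewrite -Fl derive1E; exact: dF.
move=> /cvgr_dist_lt dFl; apply/cvgrPdist_lt => e e0.
have /(@nbhs_ballP R R^o)[d /= d0 hd] := dFl e e0.
have [N _ hN] := cvgr0_norm_lt _ (@cvg_harmonic R) _ d0.
exists N => // n /= Nn.
have h0 : 0 < (harmonic n : R) by exact: harmonic_gt0.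
have := hd (harmonic n); rewrite /ball/= sub0r normrN => /(_ (hN n Nn)).
rewrite gt_eqF// => /(_ isT).
by rewrite invrK [X in X + x]mulr1 (addrC _ x).
Qed.

Section DifferenceQuotient.
Context {R : realType} {X : metricType R}.
Variable eta : R -> X.
Notation mu := (@lebesgue_measure R).

Lemma measurable_difference_quotient n :
  continuous (fun u => eta (clamp01 u)) ->
  measurable_fun [set: R] (difference_quotient eta n).
Proof.
move=> ceta; apply/measurable_EFinP.
apply: continuous_measurable_fun => u.
apply: cvgM; first exact: cvg_cst.
apply/cvgrPdist_le => e e0.
have c1 : eta (clamp01 (v + harmonic n)) @[v --> u] -->
    eta (clamp01 (u + harmonic n)).
  have cshift : v + harmonic n @[v --> u] --> u + harmonic n.
    by apply: cvgD; [exact: cvg_id|exact: cvg_cst].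
  exact: cvg_comp cshift (ceta _).
have e20 : 0 < e / 2 by rewrite divr_gt0.
near=> v.
have : mdist (eta (clamp01 (u + harmonic n))) (eta (clamp01 (v + harmonic n)))
    <= e / 2.
  by near: v; exact: metricType_numDomainType.cvgr_dist_le c1 _ e20.
have : mdist (eta (clamp01 u)) (eta (clamp01 v)) <= e / 2.
  by near: v; exact: metricType_numDomainType.cvgr_dist_le (ceta u) _ e20.
set a := eta _; set b := eta _; set c := eta _; set d := eta _.
move=> ab cd.
have := metric_triangle c d a; have := metric_triangle d c b.
have := metric_triangle d b a; have := metric_triangle c a b.
rewrite (metric_sym d c) (metric_sym b a).
rewrite ler_norml; lra.
Unshelve. all: by end_near. Qed.

End DifferenceQuotient.

Lemma continuous_clamp01 (R : realType) (Y : topologicalType) (f : R -> Y) :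
  {within `[0, 1], continuous f} -> continuous (fun u => f (clamp01 u)).
Proof.
move=> /subspace_continuousP cf u A fA.
have cI : `[0, 1]%classic (clamp01 u) by rewrite /= in_itv/= clamp01_itv.
have h : nbhs u (fun v => `[0, 1]%classic (clamp01 v) -> A (f (clamp01 v))).
  exact: clamp01_continuous (cf _ cI A fA).
by apply: filterS h => v /= hv; apply: hv; rewrite in_itv/= clamp01_itv.
Qed.

Section CurveLength.
Context {R : realType} {X : metricType R}.
Variables (eta : R -> X) (g : R -> R).
Notation mu := (@lebesgue_measure R).
Hypothesis ig : mu.-integrable `[0, 1] (EFin \o g).
Hypothesis etag : forall s r, 0 <= s -> s <= r -> r <= 1 ->
  ((mdist (eta s) (eta r))%:E <= \int[mu]_(z in `[s, r]) (g z)%:E)%E.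

(** The absolute value makes the primitive [F] nondecreasing, and the extension by 0 is integrable
    on the whole line, as needed to differentiate [F] almost everywhere. *)
Let f0 : R -> R := (fun z => `|g z|) \_ `[0, 1].

Let if0 : mu.-integrable setT (EFin \o f0).
Proof.
rewrite /f0 -restrict_EFin; apply/integrable_restrict => //; rewrite setTI.
have := integrable_abse ig.
by apply: eq_integrable.
Qed.

Let f0_ge0 z : 0 <= f0 z.
Proof. by rewrite /f0 patchE; case: ifP. Qed.

Let F (x : R) : R := (\int[mu]_(t in `[0, x]) f0 t)%R.

Let if0S (A : set R) : measurable A -> mu.-integrable A (EFin \o f0).
Proof. by move=> mA; apply: integrableS if0. Qed.

Let FB s r : 0 <= s -> s <= r ->
  ((F r - F s)%:E = \int[mu]_(z in `[s, r]) (f0 z)%:E)%E.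
Proof.
move=> s0 sr; rewrite /F Rintegral_itvB ?bnd_simp//; last exact: if0S.
rewrite Rintegral_itv_obnd_cbnd; last exact: if0S.
by rewrite /Rintegral fineK//; apply: integrable_fin_num => //; exact: if0S.
Qed.

Let F_mono s r : 0 <= s -> s <= r -> F s <= F r.
Proof.
move=> s0 sr; rewrite -subr_ge0 -lee_fin FB//.
by apply: integral_ge0 => z _; rewrite lee_fin.
Qed.

Let F_dist s r : 0 <= s -> s <= r -> r <= 1 -> mdist (eta s) (eta r) <= F r - F s.
Proof.
move=> s0 sr r1; rewrite -lee_fin FB//; apply: le_trans (etag s0 sr r1) _.
have sub : `[s, r] `<=` `[0%R, 1%R].
  by apply: subset_itv; rewrite bnd_simp.
apply: le_integral => //.
- exact: integrableS ig.
- exact: if0S.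
- move=> z; rewrite inE => zsr; rewrite lee_fin /f0 patchE ifT ?ler_norm//.
  by rewrite inE; exact: sub.
Qed.

Let F_continuous : {within `[0, 1], continuous F}.
Proof.
by apply: parameterized_integral_continuous => //; exact: if0S.
Qed.

Let Fc_continuous : continuous (fun u => F (clamp01 u)).
Proof. exact: continuous_clamp01 F_continuous. Qed.

Lemma AC_curve_continuous : continuous (fun u => eta (clamp01 u)).
Proof.
move=> u; apply/metricType_numDomainType.cvgrPdist_lt => e e0; near=> v.
apply: (@le_lt_trans _ _ `|F (clamp01 u) - F (clamp01 v)|).
  have /andP[u0 u1] := clamp01_itv u; have /andP[v0 v1] := clamp01_itv v.
  have [uv|/ltW vu] := leP (clamp01 u) (clamp01 v).
    rewrite distrC ger0_norm ?subr_ge0 ?F_mono//; exact: F_dist.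
  rewrite metric_sym ger0_norm ?subr_ge0 ?F_mono//; exact: F_dist.
by near: v; apply: cvgr_dist_lt => //; exact: Fc_continuous.
Unshelve. all: by end_near. Qed.

Lemma measurable_curve_speed : measurable_fun [set: R] (curve_speed eta).
Proof.
apply: measurable_fun_limn_esup => n; apply: measurable_difference_quotient.
exact: AC_curve_continuous.
Qed.

Let F_derive : {ae mu, forall x, 0 < x ->
  derivable F x 1 /\ derive1 F x = f0 x}.
Proof.
have lf0 : locally_integrable [set: R] f0.
  apply: integrable_locally => //; have := integrable_abse ig.
  by apply: eq_integrable.
have := @FTC1 R f0 (BLeft 0) (fun y => if0S (measurable_itv _)) lf0.
apply: filterS; first exact: (ae_filter_ringOfSetsType mu).
by move=> x /= h x0; apply: h; rewrite lte_fin.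
Qed.

(* Apply Fatou's lemma to the difference quotients of the nondecreasing function
   H r = F r - d(eta s, eta r), where F is a primitive of |g|: since F' = |g|
   almost everywhere, their lower limit is at least |g| minus the speed. This
   avoids differentiating the absolutely continuous function d(eta s, eta r). *)
Lemma mdist_le_integral_speed s r : 0 <= s -> s <= r -> r <= 1 ->
  ((mdist (eta s) (eta r))%:E <= \int[mu]_(u in `[s, r]) curve_speed eta u)%E.
Proof.
move=> s0; rewrite le_eqVlt => /orP[/eqP <- _|sr r1].
  by rewrite mdistxx set_itv1 integral_set1.
have s1 : s <= 1 by lra.
pose K x := F x - mdist (eta s) (eta x).
(* Monotonicity of [K] is available on [s, 1]; freezing [K] outside gives the globally continuous,
   nondecreasing [H] that [integral_increment_le] asks for. *)
pose c u := clamp01 (Num.max s u).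
pose H u := K (c u).
have cE u : s <= u <= 1 -> c u = u.
  by move=> /andP[su u1]; rewrite /c (max_r su) clamp01_id// u1 (le_trans s0).
have cs u : s <= c u <= 1.
  have /andP[_ ->] := clamp01_itv (Num.max s u); rewrite andbT.
  rewrite -[leLHS]clamp01_id ?s0//; apply: clamp01_mono.
  by rewrite le_max lexx.
have Kmono x y : s <= x -> x <= y -> y <= 1 -> K x <= K y.
  move=> sx xy y1.
  have := F_dist (le_trans s0 sx) xy y1.
  have := metric_triangle (eta s) (eta x) (eta y); rewrite /K; lra.
have Hmono : {homo H : u v / u <= v}.
  move=> u v uv; have /andP[? ?] := cs u; have /andP[? ?] := cs v.
  apply: Kmono => //; apply: clamp01_mono.
  by rewrite ge_max !le_max lexx uv orbT.
have cH : continuous H.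
  have cK : continuous (fun u => K (clamp01 u)).
    move=> u; apply: cvgB; first exact: Fc_continuous.
    apply/cvgrPdist_lt => e e0; near=> v.
    apply: (@le_lt_trans _ _ (mdist (eta (clamp01 u)) (eta (clamp01 v)))).
      have := metric_triangle (eta s) (eta (clamp01 u)) (eta (clamp01 v)).
      have := metric_triangle (eta s) (eta (clamp01 v)) (eta (clamp01 u)).
      rewrite (metric_sym (eta (clamp01 v))) ler_norml; lra.
    near: v; apply: metricType_numDomainType.cvgr_dist_lt => //.
    exact: AC_curve_continuous.
  have cmax u : Num.max s v @[v --> u] --> Num.max s u.
    by apply: continuous_max; [exact: cvg_cst|exact: cvg_id].
  by move=> u; exact: cvg_comp (cmax u) (cK _).
pose psi n u := (n.+1%:R * H (u + harmonic n) - n.+1%:R * H u)%:E.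
pose linf u := limn_einf (psi ^~ u).
have psi0 n u : (0 <= psi n u)%E.
  rewrite lee_fin subr_ge0 ler_pM2l//; apply: Hmono.
  by rewrite lerDl harmonic_ge0.
have mpsi n : measurable_fun `[s, r] (psi n).
  apply: measurable_funS (measurableT) (@subsetT _ _) _.
  apply/measurable_EFinP; apply: continuous_measurable_fun => u.
  apply: cvgB; (apply: cvgM; first exact: cvg_cst); last exact: cH.
  have cshift : v + harmonic n @[v --> u] --> u + harmonic n.
    by apply: cvgD; [exact: cvg_id|exact: cvg_cst].
  exact: cvg_comp cshift (cH _).
have mspeed : measurable_fun `[s, r] (curve_speed eta).
  exact: measurable_funS measurableT (@subsetT _ _) measurable_curve_speed.
have mliminf : measurable_fun `[s, r] linf.
  rewrite /linf /limn_einf; apply: measurableT_comp => //.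
  by apply: measurable_fun_limn_esup => n; apply: measurableT_comp.
have liminf0 u : (0 <= linf u)%E.
  by apply: (@limn_einf_ge _ _ _ 0%N).
have intpsi n : (\int[mu]_(u in `[s, r]) psi n u <= (H (r + harmonic n) - H s)%:E)%E.
  have := @integral_increment_le R (fun u => n.+1%:R * H u) s r (harmonic n).
  rewrite -mulrBr mulrA mulVf// mul1r; apply => //.
  - by move=> u; apply: cvgM; [exact: cvg_cst|exact: cH].
  - by move=> u v uv; rewrite ler_pM2l//; exact: Hmono.
  - exact: harmonic_gt0.
have lim_intpsi :
    (limn_einf (fun n => \int[mu]_(u in `[s, r]) psi n u) <= (H r - H s)%:E)%E.
  apply: le_trans (limn_einf_sup _) _; apply/lee_addgt0Pr => e e0.
  have : H (r + harmonic n) @[n --> \oo] --> H r.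
    have cshift : r + harmonic n @[n --> \oo] --> r.
      rewrite -[X in _ --> X]addr0.
      by apply: cvgD; [exact: cvg_cst|exact: cvg_harmonic].
    exact: cvg_comp cshift (cH _).
  move=> /cvgr_dist_lt/(_ e e0)[N _ hN].
  apply: (@limf_esup_le _ _ _ _ _ _ [set n | (N <= n)%N]); first by exists N.
  move=> n /hN /= hn; apply: le_trans (intpsi n) _.
  rewrite -EFinD lee_fin; move: hn; rewrite ltr_norml; lra.
(* By the triangle inequality [psi n u] is at least the quotient of [F] minus the quotient of [eta].
   Where [F] is differentiable, the first eventually exceeds [f0 u - e / 2] and the second stays
   below the speed plus [e / 2]. *)
have ae_bound : {ae mu, forall u, `[s, r]%classic u ->
    ((f0 u)%:E <= linf u + curve_speed eta u)%E}.
  have neq a : {ae mu, forall u, u != a}.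
    exists [set a]; split => //; first exact: lebesgue_measure_set1.
    by move=> u /= /negP; rewrite negbK => /eqP.
  apply: (@filterS3 _ _ (ae_filter_ringOfSetsType mu) _ _ _ _ _
    F_derive (neq 0) (neq 1)) => u hu une0 une1.
  rewrite /= in_itv/= => /andP[su ur].
  have u0 : 0 < u by rewrite lt_neqAle eq_sym une0 (le_trans s0).
  have [dF F'] := hu u0.
  have u1 : u < 1 by rewrite lt_neqAle une1 (le_trans ur).
  have := curve_speed_ge0 eta u.
  case vE : (curve_speed eta u) => [v| |] // v0; last first.
    by rewrite addey ?leey// -ltNye (lt_le_trans _ (liminf0 u)).
  apply/lee_addgt0Pr => e e0.
  have e20 : 0 < e / 2 by rewrite divr_gt0.
  have [V [N1 _ N1V] hV] : exists2 V, \oo V &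
      forall n, V n -> (difference_quotient eta n u < (v + e / 2)%:E)%E.
    by apply: limf_esup_lt; rewrite -/(limn_esup _) -/(curve_speed _ _) vE lte_fin ltrDl.
  have /cvgr_dist_lt/(_ _ e20)[N2 _ hN2] := difference_quotient_cvg dF F'.
  have d0 : 0 < 1 - u by rewrite subr_gt0.
  have [N3 _ hN3] := cvgr0_norm_lt _ (@cvg_harmonic R) _ d0.
  suff : ((f0 u - v - e)%:E <= linf u)%E.
    move=> h; rewrite -addeA -EFinD -leeBlDr// -EFinB; apply: le_trans h.
    by rewrite lee_fin; lra.
  apply: (@limn_einf_ge _ _ _ (maxn N1 (maxn N2 N3))) => n.
  rewrite !geq_max => /and3P[n1 n2 n3].
  have {N1V hV n1} := hV n (N1V n n1); rewrite lte_fin.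
  have {hN2 n2} := hN2 n n2; have {hN3 n3} := hN3 n n3 => /=.
  have h0 : 0 < (n.+1%:R^-1 : R) by rewrite invr_gt0.
  rewrite gtr0_norm// => h1.
  have sun : s <= u + n.+1%:R^-1 <= 1.
    by rewrite (le_trans su) ?lerDl ?(ltW h0)//= -lerBrDl ltW.
  have /andP[sun1 sun2] := sun.
  rewrite lee_fin /H !cE ?su ?(ltW u1)//= !clamp01_id ?(ltW u0) ?(ltW u1)//; last first.
    by rewrite sun2 (le_trans s0).
  rewrite ltr_norml => /andP[_ hF] hd; rewrite -mulrBr.
  have hn : n.+1%:R * (F (u + n.+1%:R^-1) - F u)
      - n.+1%:R * mdist (eta (u + n.+1%:R^-1)) (eta u)
      <= n.+1%:R * (K (u + n.+1%:R^-1) - K u).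
    rewrite -mulrBr ler_pM2l// /K.
    by have := metric_triangle (eta s) (eta u) (eta (u + n.+1%:R^-1));
      rewrite (metric_sym (eta u)); lra.
  lra.
(* The left side is [F r - F s] and [H r - H s] is the same number minus the distance; cancelling
   [F] leaves the claim. *)
have H1 : (\int[mu]_(u in `[s, r]) (f0 u)%:E <=
    (H r - H s)%:E + \int[mu]_(u in `[s, r]) curve_speed eta u)%E.
  apply: (@le_trans _ _ (\int[mu]_(u in `[s, r]) (linf u + curve_speed eta u))%E).
    apply: ae_ge0_le_integral => //.
    - by move=> ? _; rewrite lee_fin.
    - by apply: measurable_funS (measurableT) (@subsetT _ _) _; case/integrableP: if0.
    - by move=> ? _; rewrite adde_ge0// curve_speed_ge0.
    - exact: emeasurable_funD.
  rewrite ge0_integralD//; last first.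
    by move=> ? _; exact: curve_speed_ge0.
  apply: leeD => //; apply: le_trans lim_intpsi.
  exact: fatou.
have Hr : H r = F r - mdist (eta s) (eta r) by rewrite /H cE//; lra.
have Hs : H s = F s by rewrite /H cE ?lexx//= /K mdistxx subr0.
move: H1; rewrite -FB ?(ltW sr)// Hr Hs.
case: (\int[mu]_(u in `[s, r]) curve_speed eta u)%E => [I||]; rewrite ?leey//.
by rewrite -EFinD !lee_fin; lra.
Unshelve. all: by end_near. Qed.

End CurveLength.

Import HBNNSimple.

(** The integral of a nonnegative function is a supremum over the simple functions below it, so
    monotonicity needs no measurability. It serves to compare [curve_speed] with
    [metric_derivative]. *)
Lemma ge0_le_integral_nonmeasurable d (T : measurableType d) (R : realType)
    (mu : {measure set T -> \bar R}) (D : set T) (f1 f2 : T -> \bar R) :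
  (forall x, D x -> (0 <= f1 x)%E) -> (forall x, D x -> (f1 x <= f2 x)%E) ->
  (\int[mu]_(x in D) f1 x <= \int[mu]_(x in D) f2 x)%E.
Proof.
move=> f10 f12; rewrite !(integral_mkcond D).
have h10 x : (0 <= (f1 \_ D) x)%E by apply: erestrict_ge0.
have h12 x : ((f1 \_ D) x <= (f2 \_ D) x)%E by apply: lee_restrict.
rewrite !ge0_integralTE//; last by move=> x; exact: le_trans (h10 x) (h12 x).
apply: ereal_sup_le => _ [h /= hf <-]; exists h => // x.
exact: le_trans (hf x) (h12 x).
Qed.

Section PathSpace.
Context {R : realType} {X : metricType R}.
Notation mu := (@lebesgue_measure R).

(** Here [v] is the speed accumulated along a curve that nearly attains the infimum. Such an
    additive majorant of the distance replaces a parametrization by arc length. *)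
Lemma almost_geodesic (x y : X) (e : R) : path_space X -> 0 < e ->
  exists (eta : R -> X) (v : R -> R),
    [/\ continuous (fun u => eta (clamp01 u)), eta 0 = x /\ eta 1 = y,
        v 0 = 0, v 1 <= mdist x y + e
      & forall s r, 0 <= s -> s <= r -> r <= 1 ->
          mdist (eta s) (eta r) <= v r - v s].
Proof.
move=> pX e0.
have : (ereal_inf [set (\int[mu]_(s in `[0%R, 1%R]) metric_derivative eta s)%E
        | eta in [set eta : R -> X | [/\ AC01 eta, eta 0%R = x & eta 1%R = y]]]
        < (mdist x y + e)%:E)%E.
  by rewrite -pX lte_fin ltrDl.
move=> /ereal_inf_lt[_ [eta [[g ig etag] eta0 eta1] <-]] len.
have ms := measurable_curve_speed ig etag.
have msS (A : set R) : measurable_fun A (curve_speed eta).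
  exact: measurable_funS measurableT (@subsetT _ _) ms.
pose V (r : R) : \bar R := (\int[mu]_(u in `[0%R, r]) curve_speed eta u)%E.
have V1 : (V 1%R <= (mdist x y + e)%:E)%E.
  apply: le_trans (ltW len); apply: ge0_le_integral_nonmeasurable => u.
    by move=> _; exact: curve_speed_ge0.
  by rewrite /= in_itv/=; exact: curve_speed_le_metric_derivative.
have Vfin r : r <= 1 -> V r \is a fin_num.
  move=> r1; rewrite ge0_fin_numE; last first.
    by apply: integral_ge0 => u _; exact: curve_speed_ge0.
  apply: (@le_lt_trans _ _ (mdist x y + e)%:E); last exact: ltey.
  apply: le_trans V1; apply: ge0_subset_integral => //.
  - exact: msS.
  - by move=> ? _; exact: curve_speed_ge0.
  - by apply: subset_itvl; rewrite bnd_simp.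
exists eta, (fine \o V); split => //.
- by apply: AC_curve_continuous ig etag.
- by rewrite /= /V set_itv1 integral_set1.
- by rewrite /= -lee_fin fineK ?Vfin.
- move=> s r s0 sr r1; rewrite /= -lee_fin EFinB !fineK ?Vfin ?(le_trans sr)//.
  rewrite leeBrDr ?Vfin ?(le_trans sr)//.
  apply: le_trans (leeD (mdist_le_integral_speed ig etag s0 sr r1) (lexx _)) _.
  rewrite /V [in leRHS](@itv_bndbnd_setU _ _ _ (BRight s)) ?bnd_simp//.
  rewrite [leRHS]ge0_integral_setU//; last 3 first.
  - exact: msS.
  - by move=> u _; exact: curve_speed_ge0.
  - apply/disj_set2P; rewrite -subset0 => u [] /=; rewrite !in_itv/=.
    by move=> /andP[_ us] /andP[su _]; lra.
  by rewrite [leLHS]addeC; apply: leeD => //; rewrite integral_itv_obnd_cbnd.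
Qed.

End PathSpace.

(** * Growth of the energy in space and time *)

Section Slope.
Context {R : realType} {X : metricType R}.
Variables (E : R -> X -> R) (T : R).

Lemma slope_upper_bound t (x : X) (e : R) :
  slope E t x \is a fin_num -> 0 < e ->
  exists2 d : R, 0 < d & forall y, mdist x y < d ->
    E t x - E t y <= (fine (slope E t x) + e) * mdist x y.
Proof.
move=> sfin e0; set c := fine (slope E t x).
have ce0 : 0 <= c + e.
  by rewrite addr_ge0 ?(ltW e0)// fine_ge0// /slope le_max lexx.
have : (limf_esup (fun y : X => (Num.max (E t x - E t y) 0 / mdist x y)%:E) x^'
    < (c + e)%:E)%E.
  apply: (@le_lt_trans _ _ (slope E t x)); first by rewrite /slope le_max lexx orbT.
  by rewrite -(fineK sfin) lte_fin ltrDl.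
move=> /limf_esup_lt[V xV Vlt].
move: xV => /metricType_numDomainType.nbhs_mdistP[d /= d0 dV].
exists d => // y xyd.
have [<-|xy] := eqVneq x y; first by rewrite subrr mdistxx mulr0.
have yV : V y by apply: dV => //=; rewrite eq_sym.
have xy0 : 0 < mdist x y by rewrite mdist_gt0.
have := Vlt y yV; rewrite lte_fin ltr_pdivrMr// => h.
by apply: le_trans (ltW h); rewrite le_max lexx.
Qed.

Lemma slope_eq0 t (x : X) (C : R) : 0 < C ->
  (forall y, E t x - E t y <= C * mdist x y ^+ 2) -> slope E t x = 0%E.
Proof.
move=> C0 hC; rewrite /slope; apply/max_idPl/lee_addgt0Pr => e e0.
rewrite add0e.
apply: (@limf_esup_le _ _ _ _ _ _ [set y | mdist x y < e / C /\ y != x]).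
  apply/metricType_numDomainType.nbhs_mdistP; exists (e / C) => /=.
    by rewrite divr_gt0.
  by move=> y /= xy yx; split.
move=> y [xye yx].
have xy0 : 0 < mdist x y by rewrite mdist_gt0 eq_sym.
rewrite lee_fin ler_pdivrMr//.
move: xye; rewrite ltr_pdivlMr// => xye; have := hC y.
rewrite expr2 => hy; rewrite ge_max (ltW (mulr_gt0 e0 xy0)) andbT.
apply: le_trans hy _; rewrite mulrA ler_pM2r// mulrC; exact: ltW.
Qed.

Lemma energy_near t (x : X) (e : R) : regular_energy E T -> 0 <= t <= T -> 0 < e ->
  exists2 d : R, 0 < d & forall t' x', 0 <= t' <= T -> `|t - t'| < d ->
    mdist x x' < d -> `|E t x - E t' x'| < e.
Proof.
move=> [/subspace_continuousP cE _ _ _ _] tT e0.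
have /cvgr_dist_lt/(_ _ e0) := cE (t, x) tT.
rewrite /within /= => -[[A B] /= [At Bx] AB].
move: At => /(@nbhs_ballP R R^o)[d1 /= d10 hA].
move: Bx => /metricType_numDomainType.nbhs_mdistP[d2 /= d20 hB].
exists (Num.min d1 d2); first by rewrite lt_min d10.
move=> t' x' t'T; rewrite !lt_min => /andP[td _] /andP[_ xd].
by apply: (AB (t', x')) => //; split => /=; [exact: hA|exact: hB].
Qed.

(* The set of times up to which the bound holds along the curve is closed, and
   open to the right because the slope at [eta s] is at most [L * v s]. *)
Lemma critical_quadratic_growth_along (L : R) t (x : X) (e : R)
    (eta : R -> X) (v : R -> R) :
  regular_energy E T -> slope_lipschitz E T L -> 0 < L -> 0 <= t <= T ->
  slope E t x = 0%E -> 0 < e ->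
  continuous (fun u => eta (clamp01 u)) -> eta 0 = x -> v 0 = 0 ->
  (forall s r, 0 <= s -> s <= r -> r <= 1 ->
    mdist (eta s) (eta r) <= v r - v s) ->
  E t x - E t (eta 1) <= L / 2 * v 1 ^+ 2 + e * v 1.
Proof.
move=> rE lipE L0 tT sx0 e0 ceta eta0 v0 vP.
(* Its derivative [L * a + e] is the Lipschitz bound of the slope at arc length a, plus the error
   with which a slope controls finite increments. *)
pose phi (a : R) := L / 2 * a ^+ 2 + e * a.
have vmono s r : 0 <= s -> s <= r -> r <= 1 -> v s <= v r.
  by move=> s0 sr r1; rewrite -subr_ge0; apply: le_trans (mdist_ge0 _ _) (vP s r s0 sr r1).
have v_ge0 s : 0 <= s -> s <= 1 -> 0 <= v s.
  by move=> s0 s1; rewrite -v0; apply: vmono.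
have phi_mono a b : 0 <= a -> a <= b -> phi a <= phi b.
  move=> a0 ab; rewrite lerD ?ler_pM2l// ?divr_gt0//.
  by rewrite !expr2 ler_pM.
pose S := [set s : R | 0 <= s <= 1 /\ forall r, 0 <= r <= s ->
  E t x - E t (eta r) <= phi (v r)].
have S0 : S 0.
  split; first by rewrite lexx ler01.
  move=> r; rewrite -eq_le => /eqP <-.
  by rewrite eta0 subrr v0 /phi expr2 !mulr0 addr0.
have hS : has_sup S.
  by split; [exists 0|exists 1 => s [/andP[]]].
pose a := sup S.
have a0 : 0 <= a by apply: ub_le_sup => //; exact: hS.2.
have a1 : a <= 1 by apply: ge_sup; [exists 0|move=> s [/andP[]]].
have lt_a r : 0 <= r -> r < a -> E t x - E t (eta r) <= phi (v r).
  move=> r0 ra; have [s [sI hs] rs] := sup_gt (ex_intro _ 0 S0) ra.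
  by apply: hs; rewrite r0 ltW.
have near_a (d : R) : 0 < d -> exists2 d' : R, 0 < d' &
    forall r, 0 <= r <= 1 -> `|a - r| < d' -> mdist (eta a) (eta r) < d.
  move=> d0; have /metricType_numDomainType.cvgrPdist_lt/(_ _ d0) := ceta a.
  move=> /(@nbhs_ballP R R^o)[d' /= d'0 h]; exists d' => // r r01 ar.
  by have := h r ar; rewrite /= !clamp01_id// a0.
have at_a : E t x - E t (eta a) <= phi (v a).
  have [->|an0] := eqVneq a 0; first by apply: S0.2; rewrite !lexx.
  have ap : 0 < a by rewrite lt_neqAle eq_sym an0.
  rewrite leNgt; apply/negP; rewrite -subr_gt0 => /(energy_near (eta a) rE tT)[d d0 hd].
  have [d' d'0 hd'] := near_a d d0.
  pose r := Num.max 0 (a - d' / 2).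
  have r0 : 0 <= r by rewrite le_max lexx.
  have ra : r < a by rewrite gt_max ap /= ltrBlDr ltrDl divr_gt0.
  have rd : `|a - r| < d'.
    rewrite gtr0_norm ?subr_gt0// ltrBlDr -ltrBlDl lt_max; apply/orP; right; lra.
  have r1 : r <= 1 by rewrite (le_trans (ltW ra)).
  have := hd t (eta r) tT; rewrite subrr normr0 => /(_ d0 (hd' r _ rd)).
  rewrite r0 r1 => /(_ isT); rewrite ltr_norml => /andP[+ _].
  have := lt_a r r0 ra; have := phi_mono _ _ (v_ge0 r r0 r1) (vmono r a r0 (ltW ra) a1).
  lra.
have [aE|an1] := eqVneq a 1; first by rewrite -[in eta 1]aE -[in v 1]aE.
have al1 : a < 1 by rewrite lt_neqAle an1.
exfalso.
have sfin y : slope E t y \is a fin_num by case: rE => _ _ _ h _; exact: h.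
have [d d0 hd] := slope_upper_bound (sfin (eta a)) e0.
have [d' d'0 hd'] := near_a d d0.
pose b := Num.min 1 (a + d' / 2).
have ab : a < b by rewrite lt_min al1 /= ltrDl divr_gt0.
have b1 : b <= 1 by rewrite ge_min lexx.
have bd : b < a + d' by rewrite gt_min; apply/orP; right; lra.
suff : S b by move=> Sb; have := ub_le_sup hS.2 Sb; rewrite -/a leNgt ab.
split; first by rewrite b1 (le_trans a0) ?ltW.
move=> r /andP[r0 rb]; have [ra|ar] := ltP r a; first exact: lt_a.
have r1 : r <= 1 by rewrite (le_trans rb).
have dar : mdist (eta a) (eta r) < d.
  by apply: hd'; rewrite ?r0// distrC ger0_norm ?subr_ge0//; lra.
have slope_a : fine (slope E t (eta a)) <= L * v a.
  have := lipE t (eta a) x tT; rewrite sx0 subr0 => /(le_trans (ler_norm _)).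
  move=> /le_trans; apply; rewrite ler_pM2l// metric_sym -eta0.
  by have := vP 0 a (lexx _) a0 a1; rewrite v0 subr0.
have h1 := hd _ dar.
have h2 : (fine (slope E t (eta a)) + e) * mdist (eta a) (eta r) <=
    (L * v a + e) * (v r - v a).
  apply: ler_pM => //; last exact: vP.
  - by rewrite addr_ge0 ?(ltW e0)// fine_ge0// /slope le_max lexx.
  - exact: mdist_ge0.
  - by rewrite lerD2r.
have va0 := v_ge0 a a0 a1.
have hr := vmono a r a0 ar r1.
(* Convexity: [phi] lies above its tangent at [v a]. *)
have : (L * v a + e) * (v r - v a) <= phi (v r) - phi (v a).
  rewrite /phi -subr_ge0.
  have -> : L / 2 * v r ^+ 2 + e * v r - (L / 2 * v a ^+ 2 + e * v a) -
    (L * v a + e) * (v r - v a) = L / 2 * (v r - v a) ^+ 2 by field.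
  by rewrite mulr_ge0 ?divr_ge0 ?(ltW L0) ?sqr_ge0.
lra.
Qed.

Lemma critical_quadratic_growth (L : R) t (x y : X) :
  path_space X -> regular_energy E T -> slope_lipschitz E T L -> 0 < L ->
  0 <= t <= T -> slope E t x = 0%E ->
  E t x - E t y <= L / 2 * mdist x y ^+ 2.
Proof.
move=> pX rE lipE L0 tT sx0; apply/ler_addgt0Pr => e e0.
set d := mdist x y; have d0 : 0 <= d by exact: mdist_ge0.
(* For [k <= 1] the length d + k and the error k together raise [L / 2 * d ^+ 2] by at most
   [k * C]. *)
pose C := L * d + L / 2 + d + 1.
have C0 : 0 < C by rewrite /C; have := mulr_ge0 (ltW L0) d0; lra.
pose k := Num.min 1 (e / C).
have k0 : 0 < k by rewrite lt_min ltr01 divr_gt0.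
have k1 : k <= 1 by rewrite ge_min lexx.
have kC : k * C <= e by rewrite -ler_pdivlMr// ge_min lexx orbT.
have [eta [v [ceta [eta0 eta1] v0 v1 vP]]] := @almost_geodesic R X x y k pX k0.
have := critical_quadratic_growth_along rE lipE L0 tT sx0 k0 ceta eta0 v0 vP.
rewrite eta1 => /le_trans; apply.
have v10 : 0 <= v 1.
  by have := le_trans (mdist_ge0 _ _) (vP 0 1 (lexx _) ler01 (lexx _));
    rewrite v0 subr0.
have h : L / 2 * v 1 ^+ 2 + k * v 1 <= L / 2 * (d + k) ^+ 2 + k * (d + k).
  rewrite lerD ?ler_pM2l ?divr_gt0//.
  by rewrite !expr2 ler_pM.
apply: le_trans h _.
have kk : k ^+ 2 <= k by rewrite expr2 ler_piMl// ltW.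
apply: le_trans (_ : L / 2 * d ^+ 2 + k * C <= _); last by rewrite lerD2l.
rewrite /C -subr_ge0.
have -> : L / 2 * d ^+ 2 + k * (L * d + L / 2 + d + 1) -
  (L / 2 * (d + k) ^+ 2 + k * (d + k)) = (L / 2 + 1) * (k - k ^+ 2) by field.
by rewrite mulr_ge0 ?subr_ge0//; lra.
Qed.

End Slope.

(** * Energy bounds across times, from the control of the power *)

Section Gronwall.
Context {R : realType} {X : metricType R}.
Variables (E : R -> X -> R) (T : R).

Lemma is_derive_energy t x : regular_energy E T -> 0 < t < T ->
  is_derive t 1 (E ^~ x) (time_derivative E T t x).
Proof.
move=> [_ dE _ _ _] /andP[t0 tT].
have tI : 0 <= t <= T by rewrite !ltW.
have /cvg_ex[l hl] := dE t x tI.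
have -> : time_derivative E T t x = l.
  (* Points strictly between t and T lie arbitrarily close to t; properness makes the limit unique,
     so [lim] equals l. *)
  have pF : ProperFilter (within `[0, T] t^').
    have FF := @filter_filter _ _ (Proper_dnbhs_numFieldType t).
    refine (Build_ProperFilter _ (within_filter _ FF)).
    move=> /(@nbhs_ballP R R^o)[d /= d0 hd].
    pose k := Num.min d (T - t).
    have k0 : 0 < k by rewrite lt_min d0 subr_gt0.
    have [kd kT] : k <= d /\ k <= T - t by rewrite /k !ge_min !lexx orbT.
    apply: (hd (t + k / 2)).
    - rewrite /ball/= opprD addNKr normrN gtr0_norm; lra.
    - by rewrite gt_eqF// ltrDl divr_gt0.
    - by rewrite in_itv/=; lra.
  exact: (cvg_lim (@Rhausdorff R) hl).
have : h^-1 *: (E (h *: 1 + t) x - E t x) @[h --> 0^'] --> l.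
  apply/cvgrPdist_lt => e e0.
  have /cvgr_dist_lt/(_ _ e0) := hl.
  rewrite /within /= => /(@nbhs_ballP R R^o)[d /= d0 hd].
  have d'0 : 0 < Num.min d (Num.min t (T - t)) by rewrite !lt_min d0 t0 subr_gt0.
  apply/(@nbhs_ballP R R^o); exists (Num.min d (Num.min t (T - t))) => // h.
  rewrite /ball/= sub0r normrN !lt_min => /and3P[hd' ht hT] hn0.
  have := hd (h + t); rewrite /ball/= (_ : t - (h + t) = - h); last by ring.
  rewrite normrN => /(_ hd').
  have -> : h + t != t by rewrite -subr_eq0 addrK.
  move=> /(_ isT); rewrite in_itv/=.
  have -> : 0 <= h + t <= T by move: ht hT; rewrite !ltr_norml; lra.
  move=> /(_ isT); rewrite /time_quotient addrK.
  by rewrite [_ *: 1]mulr1 mulrC.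
move=> hq; apply: DeriveDef.
  by apply/cvg_ex; exists l.
exact: (cvg_lim (@Rhausdorff R) hq).
Qed.

Lemma energy_time_continuous x a b : regular_energy E T -> 0 <= a -> b <= T ->
  {within `[a, b], continuous (E ^~ x)}.
Proof.
move=> rE a0 bT; apply/subspace_continuousP => t /=; rewrite in_itv/= => /andP[at_ tb].
have tT : 0 <= t <= T by rewrite (le_trans a0)// (le_trans tb).
apply/cvgrPdist_lt => e e0.
have [d d0 hd] := energy_near x rE tT e0.
rewrite /within /=; apply/(@nbhs_ballP R R^o); exists d => // s ts.
rewrite in_itv/= => /andP[as_ sb]; apply: hd => //.
  by rewrite (le_trans a0)// (le_trans sb).
by rewrite mdistxx.
Qed.

Lemma exp_energy_derive (x : X) (k K t : R) : regular_energy E T -> 0 < t < T ->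
  is_derive t 1 (fun s => (E s x + K) * expR (k * s))
    ((time_derivative E T t x + k * (E t x + K)) * expR (k * t)).
Proof.
move=> rE tT; have dE := is_derive_energy x rE tT.
have d1 : is_derive t 1 (fun s => E s x + K) (time_derivative E T t x).
  rewrite -[time_derivative E T t x]addr0.
  exact: is_deriveD.
have d2 : is_derive t 1 (fun s => expR (k * s)) (k * expR (k * t)).
  have d3 : is_derive t 1 (fun s => k * s) k.
    have := @is_deriveZ R R^o R^o id k t 1 1 (is_derive_id _ _).
    by rewrite [X in is_derive _ _ _ X]mulr1; apply.
  rewrite mulrC.
  exact: (@is_derive1_comp R expR (fun s => k * s)).
have := is_deriveM d1 d2.
move=> h; apply: is_derive_eq.
rewrite /GRing.scale/=; ring.
Qed.

Variables (C1 C2 : R).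
Hypotheses (rE : regular_energy E T) (C10 : 0 < C1).
Hypothesis pcE : forall t x, 0 <= t <= T ->
    `|time_derivative E T t x| <= C1 * E t x + C2.

(** The power control dominates an absolute value, so its right-hand side is nonnegative. This is
    where the lower bound of the energy comes from. *)
Lemma energy_shift_ge0 t x : 0 <= t <= T -> 0 <= E t x + C2 / C1.
Proof.
move=> tT; have := le_trans (normr_ge0 _) (pcE x tT).
have -> : C1 * E t x + C2 = C1 * (E t x + C2 / C1).
  by rewrite mulrDr mulrCA divff ?mulr1// gt_eqF.
by rewrite pmulr_rge0.
Qed.

Let gronwall_mvt (x : X) (k s t : R) : 0 <= s -> s < t -> t <= T ->
  exists2 c, 0 <= c <= T &
    (E t x + C2 / C1) * expR (k * t) - (E s x + C2 / C1) * expR (k * s) =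
    ((time_derivative E T c x + k * (E c x + C2 / C1)) * expR (k * c)) * (t - s).
Proof.
move=> s0 st tT.
pose f u := (E u x + C2 / C1) * expR (k * u).
pose df c := ((time_derivative E T c x + k * (E c x + C2 / C1)) * expR (k * c)).
have [||c] := @MVT R f df s t st.
- move=> c; rewrite in_itv/= => /andP[sc ct]; apply: exp_energy_derive => //.
  by rewrite (le_lt_trans s0)//= (lt_le_trans ct).
- apply/subspace_continuousP => u su.
  have /subspace_continuousP/(_ _ su) cE := energy_time_continuous (x := x) rE s0 tT.
  apply: cvgM; first by apply: cvgD; [exact: cE|exact: cvg_cst].
  have ck : k * w @[w --> within `[s, t] (nbhs u)] --> k * u.
    by apply: cvgM; [exact: cvg_cst|exact: cvg_within].
  exact: cvg_comp ck (@continuous_expR R _).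
rewrite in_itv/= => /andP[sc ct] e; exists c => //.
by rewrite (le_trans s0 (ltW sc))//= (le_trans (ltW ct)).
Qed.

(** Since the power is at most [C1 * (E + C2 / C1)] in absolute value, the shifted energy times
    [expR (C1 * t)] is nondecreasing in time and times [expR (- C1 * t)] nonincreasing. The two
    integrating factors cover the two orders of s and t. *)
Lemma gronwall s t (x : X) : 0 <= s <= T -> 0 <= t <= T ->
  E s x + C2 / C1 <= (E t x + C2 / C1) * expR (C1 * `|s - t|).
Proof.
move=> /andP[s0 sT] /andP[t0 tT].
have pc c : 0 <= c <= T ->
    `|time_derivative E T c x| <= C1 * (E c x + C2 / C1).
  move=> cT; apply: le_trans (pcE x cT) _.
  by rewrite mulrDr mulrCA divff ?mulr1// gt_eqF.
have [st|ts|->] := ltgtP s t; last by rewrite subrr normr0 mulr0 expR0 mulr1.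
- have [c cT e] := gronwall_mvt x C1 s0 st tT.
  rewrite distrC gtr0_norm ?subr_gt0// mulrBr expRD expRN mulrA.
  rewrite ler_pdivlMr ?expR_gt0// -subr_ge0 e.
  rewrite mulr_ge0 ?subr_ge0 ?(ltW st)// mulr_ge0 ?expR_ge0//.
  by have := pc c cT; rewrite ler_norml; lra.
- have [c cT e] := gronwall_mvt x (- C1) t0 ts sT.
  rewrite gtr0_norm ?subr_gt0// mulrBr expRD.
  have : (E s x + C2 / C1) * expR (- C1 * s) <= (E t x + C2 / C1) * expR (- C1 * t).
    rewrite -subr_le0 e.
    rewrite mulr_le0_ge0 ?subr_ge0 ?(ltW ts)// mulr_le0_ge0 ?expR_ge0//.
    by have := pc c cT; rewrite ler_norml; lra.
  rewrite !mulNr !expRN ler_pdivrMr ?expR_gt0//.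
  by rewrite -mulrA (mulrC (expR _)^-1).
Qed.

End Gronwall.

(** * The BDF2 Lagrangian *)

Section Bdf2Estimates.
Context {R : realType} {X : metricType R}.
Variables (E : R -> X -> R) (T tau K0 : R).
Hypothesis tau0 : 0 < tau.
Hypothesis E_ge : forall t x, 0 <= t <= T -> 0 <= E t x + K0.

(** All penalty coefficients become integer multiples of k, so that inequalities between products of
    k with squared distances are linear. *)
Let k : R := (4 * tau)^-1.
Let k_gt0 : 0 < k. Proof. by rewrite invr_gt0 mulr_gt0. Qed.
Let tau_k : tau^-1 = 4 * k.
Proof. by rewrite /k invfM mulrA divff ?mul1r. Qed.
Let tau2_k : (2 * tau)^-1 = 2 * k.
Proof. by rewrite /k; field; rewrite gt_eqF. Qed.

Lemma sqr_dist_triangle (x y z : X) :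
  mdist x z ^+ 2 <= 2 * mdist x y ^+ 2 + 2 * mdist y z ^+ 2.
Proof.
have h1 := metric_triangle x y z.
have h2 : mdist x z ^+ 2 <= (mdist x y + mdist y z) ^+ 2.
  by rewrite !expr2 ler_pM ?mdist_ge0.
have := sqr_ge0 (mdist x y - mdist y z); nra.
Qed.

(** By d(y, x')^2 <= 2 d(y, x)^2 + 2 d(x, x')^2 the subtracted term consumes only half of the
    penalty. The other half gives coercivity: [bdf2_energy] is a finite infimum and its
    near-minimizers stay close to x. *)
Lemma bdf2_functional_ge t x x' y :
  E t y + (2 * tau)^-1 * mdist y x ^+ 2 - (2 * tau)^-1 * mdist x x' ^+ 2
    <= bdf2_functional E tau t x x' y.
Proof.
rewrite /bdf2_functional tau_k tau2_k -/k.
have := sqr_dist_triangle y x x'.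
rewrite -(ler_pM2l k_gt0); lra.
Qed.

Lemma bdf2_functional_lower t x x' y : 0 <= t <= T ->
  - K0 - (2 * tau)^-1 * mdist x x' ^+ 2 <= bdf2_functional E tau t x x' y.
Proof.
move=> tT; apply: le_trans (bdf2_functional_ge _ _ _ _).
have := E_ge y tT.
have : 0 <= (2 * tau)^-1 * mdist y x ^+ 2.
  by rewrite mulr_ge0 ?sqr_ge0// invr_ge0 mulr_ge0// ltW.
lra.
Qed.

Lemma bdf2_functional_has_inf t x x' : 0 <= t <= T ->
  has_inf (range (bdf2_functional E tau t x x')).
Proof.
move=> tT; split; first by exists (bdf2_functional E tau t x x' x), x.
by eexists => _ [y _ <-]; exact: bdf2_functional_lower.
Qed.

Lemma bdf2_energy_le t x x' y : 0 <= t <= T ->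
  bdf2_energy E tau t x x' <= bdf2_functional E tau t x x' y.
Proof.
move=> tT; apply: ge_inf; last by exists y.
exact: (bdf2_functional_has_inf _ _ tT).2.
Qed.

Lemma bdf2_energy_ge t x x' c :
  (forall y, c <= bdf2_functional E tau t x x' y) ->
  c <= bdf2_energy E tau t x x'.
Proof.
move=> hc; apply: lb_le_inf; first by exists (bdf2_functional E tau t x x' x), x.
by move=> _ [y _ <-].
Qed.

Lemma lagrangian_ge t a b c : 0 <= t <= T ->
  (4 * tau)^-1 * (mdist a b ^+ 2 + (mdist a b - mdist b c) ^+ 2)
    <= bdf2_lagrangian E tau t (mk3 a b c).
Proof.
move=> tT; rewrite /bdf2_lagrangian /= tau2_k -/k.
have := bdf2_energy_le b a b tT.
rewrite /bdf2_functional mdistxx expr0n/= mulr0 addr0 -/k (metric_sym b a).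
have h : mdist a c ^+ 2 <= (mdist a b + mdist b c) ^+ 2.
  by rewrite !expr2 ler_pM ?mdist_ge0 ?metric_triangle.
move: h; rewrite -(ler_pM2l k_gt0) /comp_0 /comp_m1 /comp_p1 /=; lra.
Qed.

Lemma lagrangian_ge0 t p : 0 <= t <= T -> 0 <= bdf2_lagrangian E tau t p.
Proof.
case: p => [[a b] c] tT; apply: le_trans (lagrangian_ge a b c tT).
by rewrite mulr_ge0 ?(ltW k_gt0)// addr_ge0 ?sqr_ge0.
Qed.

Lemma sqr_dist_le_lagrangian t a b c : 0 <= t <= T ->
  mdist a b ^+ 2 <= 4 * tau * bdf2_lagrangian E tau t (mk3 a b c).
Proof.
move=> tT; rewrite -ler_pdivrMl ?mulr_gt0//.
apply: le_trans (lagrangian_ge a b c tT).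
by rewrite ler_pM2l// lerDl sqr_ge0.
Qed.

Lemma lagrangian_le t a b c : 0 <= t <= T ->
  bdf2_lagrangian E tau t (mk3 a b c) <=
    E t b + K0 + tau^-1 * (mdist a b ^+ 2 + mdist b c ^+ 2).
Proof.
move=> tT; rewrite /bdf2_lagrangian /comp_0 /comp_m1 /comp_p1 /=.
have : - K0 - (2 * tau)^-1 * mdist b a ^+ 2 <= bdf2_energy E tau t b a.
  by apply: bdf2_energy_ge => y; exact: bdf2_functional_lower.
rewrite tau_k tau2_k -/k (metric_sym b a).
have := mulr_ge0 (ltW k_gt0) (sqr_ge0 (mdist a c)).
have := mulr_ge0 (ltW k_gt0) (sqr_ge0 (mdist b c)).
lra.
Qed.

Lemma energy_step_le t a b c : 0 <= t <= T ->
  E t b - E t c <= bdf2_lagrangian E tau t (mk3 a b c)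
    + (2 * tau)^-1 * (mdist b c ^+ 2 - mdist a b ^+ 2).
Proof.
move=> tT; have := bdf2_energy_le b a c tT.
rewrite /bdf2_lagrangian /bdf2_functional /comp_0 /comp_m1 /comp_p1 /=.
rewrite tau_k tau2_k -/k (metric_sym c b) (metric_sym c a); lra.
Qed.

Lemma energy_step_minimizer t a b c : 0 <= t <= T ->
  (forall y, bdf2_functional E tau t b a c <= bdf2_functional E tau t b a y) ->
  E t b - E t c = bdf2_lagrangian E tau t (mk3 a b c)
    + (2 * tau)^-1 * (mdist b c ^+ 2 - mdist a b ^+ 2).
Proof.
move=> tT hmin.
have : bdf2_energy E tau t b a = bdf2_functional E tau t b a c.
  apply: le_anti; rewrite bdf2_energy_le//=.
  by apply: bdf2_energy_ge => y; exact: hmin.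
rewrite /bdf2_lagrangian /bdf2_functional /comp_0 /comp_m1 /comp_p1 /=.
rewrite tau_k tau2_k -/k (metric_sym c b) (metric_sym c a) => ->; ring.
Qed.

Lemma sqr_diff_le (p q e D : R) : 0 <= p -> 0 <= q -> 0 <= e ->
  p <= D -> q <= D -> p - q <= e -> p ^+ 2 - q ^+ 2 <= e * (2 * D).
Proof.
move=> p0 q0 e0 pD qD pqe.
have [pq|qp] := leP p q.
  apply: (@le_trans _ _ 0); last by rewrite !mulr_ge0// (le_trans p0).
  by rewrite subr_le0 !expr2 ler_pM.
rewrite subr_sqr; apply: ler_pM => //; rewrite ?subr_ge0 ?(ltW qp)//; lra.
Qed.

Variable C1 : R.
Hypothesis C10 : 0 < C1.
Hypothesis E_gronwall : forall s t x, 0 <= s <= T -> 0 <= t <= T ->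
  E s x + K0 <= (E t x + K0) * expR (C1 * `|s - t|).

(** A near-minimizer for the primed data has bounded energy and bounded distance to b', so moving
    the base points changes its penalty by O(d), and changing the time multiplies its shifted energy
    by a factor close to 1. Energies at b and b' are compared by hypothesis, because E has no
    modulus of continuity in space that is uniform over the triples; [energy_near] supplies the
    comparison at fixed points. *)
Lemma lagrangian_modulus (M e : R) : 0 <= M -> 0 < e ->
  exists2 d : R, 0 < d & forall t t' a b c a' b' c',
    0 <= t <= T -> 0 <= t' <= T ->
    `|t - t'| < d -> mdist a a' < d -> mdist b b' < d -> mdist c c' < d ->
    E t b <= M -> E t' b' <= E t b + d -> mdist a b <= M -> mdist b c <= M ->
    bdf2_lagrangian E tau t' (mk3 a' b' c')
      <= bdf2_lagrangian E tau t (mk3 a b c) + e.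
Proof.
move=> M0 e0.
(* For a near-minimizer, [M1] bounds energy plus half penalty, [N] the shifted energy and [Q] the
   squared distance to b'; [D] bounds every distance that gets squared. The choice of [e1] gives
   [N * e1 = e / 4], and [d1] keeps the Gronwall factor below [1 + e1]. *)
pose M1 := M + 2 + 2 * k * (M + 2) ^+ 2.
pose N := `|M1 + K0| + 1.
pose Q := N / (2 * k).
pose D := Q + 2 * M + 10.
have N0 : 0 < N by rewrite ltr_wpDl.
have Q0 : 0 < Q by rewrite divr_gt0// mulr_gt0.
have D0 : 0 < D by rewrite /D; lra.
pose e1 := e / (4 * N).
have e10 : 0 < e1 by rewrite divr_gt0// mulr_gt0.
pose d1 := ln (1 + e1) / C1.
have d10 : 0 < d1 by rewrite divr_gt0// ln_gt0// ltrDl.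
(* The factor 30 adds up the quadratic errors in units of [k * D * d]: 10 from the base points
   inside the infimum, 20 from the three jump terms of the Lagrangian. *)
pose d2 := e / (4 * (30 * k * D)).
have kD0 : 0 < 30 * k * D by rewrite !mulr_gt0.
have d20 : 0 < d2 by rewrite divr_gt0// mulr_gt0.
pose d := Num.min (Num.min 1 d1) (Num.min (e / 4) d2).
have d0 : 0 < d by rewrite !lt_min ltr01 d10 d20 divr_gt0.
have [dle1 dd1 de dd2] : [/\ d <= 1, d <= d1, d <= e / 4 & d <= d2].
  by split; rewrite /d !ge_min lexx ?orbT.
have dk : 30 * k * D * d <= e / 4.
  move: dd2; rewrite /d2 invfM mulrA ler_pdivlMr// mulrC; exact.
have D1 : 2 * M + 2 <= D by rewrite /D; lra.
have D2 : Q + M + 4 <= D by rewrite /D; lra.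
have M1N : M1 + K0 <= N by rewrite /N (le_trans (ler_norm _))// lerDl.
have Ne1 : N * e1 = e / 4 by rewrite /e1; field; rewrite gt_eqF.
have e1d : expR (C1 * d) <= 1 + e1.
  rewrite -[leRHS]lnK ?posrE ?ltr_wpDr//; last by rewrite ltW.
  by rewrite ler_expR mulrC -ler_pdivlMr.
have QN : Q * (2 * k) = N by rewrite /Q divfK// gt_eqF// mulr_gt0.
clear dd1 dd2 d20 d10 kD0; clearbody d D Q N e1 d1 d2.
exists d => // t t' a b c a' b' c' tT t'T tt aa bb cc Eb Eb' ab bc.
have tri (x y z : X) : mdist x z <= mdist x y + mdist y z := metric_triangle x y z.
have dge0 (x y : X) : 0 <= mdist x y := mdist_ge0 x y.
have sym (x y : X) : mdist x y = mdist y x := metric_sym x y.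
have ab' : mdist a' b' - mdist a b <= 2 * d.
  by have := tri a' a b'; have := tri a b b'; rewrite (sym a' a); lra.
have ab'' : mdist a b - mdist a' b' <= 2 * d.
  by have := tri a a' b; have := tri a' b' b; rewrite (sym b' b); lra.
have bc' : mdist b' c' - mdist b c <= 2 * d.
  by have := tri b' b c'; have := tri b c c'; rewrite (sym b' b); lra.
have ac' : mdist a c - mdist a' c' <= 2 * d.
  by have := tri a a' c; have := tri a' c' c; rewrite (sym c' c); lra.
have ac : mdist a c <= 2 * M by have := tri a b c; lra.
have acp : mdist a' c' <= 2 * M + 2.
  by have := tri a' a c'; have := tri a c c'; rewrite (sym a' a); lra.
(* A point y violating the bound would, as a competitor for the data t, b, a, fall below the infimum
   there. *)
have EB : bdf2_energy E tau t b a - e / 2 - 10 * k * D * d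
    <= bdf2_energy E tau t' b' a'.
  rewrite leNgt; apply/negP => /inf_lt[|_ [y _ <-] hy].
    exact: (bdf2_functional_has_inf _ _ t'T).1.
  have EBM : bdf2_energy E tau t b a <= M.
    apply: le_trans (bdf2_energy_le b a b tT) _.
    rewrite /bdf2_functional mdistxx expr0n/= mulr0 addr0 -/k.
    have := mulr_ge0 (ltW k_gt0) (sqr_ge0 (mdist b a)); lra.
  have kDd0 : 0 <= 10 * k * D * d by rewrite !mulr_ge0// ltW.
  have hF' : E t' y + 2 * k * mdist y b' ^+ 2 <= M1.
    have := bdf2_functional_ge t' b' a' y; rewrite tau2_k (sym b' a').
    have : 2 * k * mdist a' b' ^+ 2 <= 2 * k * (M + 2) ^+ 2.
      by rewrite ler_pM2l ?mulr_gt0// !expr2 ler_pM//; lra.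
    rewrite /M1; lra.
  have E'y0 := E_ge y t'T.
  have yb' : mdist y b' <= Q + 1.
    have hQ : mdist y b' ^+ 2 <= Q.
      rewrite -(ler_pM2r (x := 2 * k)) ?mulr_gt0// QN mulrC; lra.
    rewrite leNgt; apply/negP => h.
    have : (Q + 1) ^+ 2 < mdist y b' ^+ 2 by rewrite !expr2 ltr_pM//; lra.
    have := sqr_ge0 Q; lra.
  have Ey : E t y - E t' y <= e / 4.
    have k1 : expR (C1 * `|t - t'|) <= 1 + e1.
      by apply: le_trans e1d; rewrite ler_expR ler_pM2l// ltW.
    have h1 : (E t' y + K0) * expR (C1 * `|t - t'|) <= (E t' y + K0) * (1 + e1).
      by rewrite ler_wpM2l.
    have h2 : (E t' y + K0) * e1 <= N * e1.
      rewrite ler_pM2r//; have := mulr_ge0 (ltW k_gt0) (sqr_ge0 (mdist y b')); lra.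
    have := E_gronwall y tT t'T; lra.
  have h1 : mdist y b ^+ 2 - mdist y b' ^+ 2 <= d * (2 * D).
    by apply: sqr_diff_le => //; try (by exact: ltW);
      have := tri y b' b; rewrite (sym b' b); lra.
  have h2 : mdist y a' ^+ 2 - mdist y a ^+ 2 <= d * (2 * D).
    by apply: sqr_diff_le => //; try (by exact: ltW);
      have := tri y b' a'; have := tri y a' a; have := tri y a a';
      rewrite (sym a' a) (sym b' a'); lra.
  have := bdf2_energy_le b a y tT; move: hy; rewrite /bdf2_functional tau_k -/k.
  move: h1 h2; rewrite -(ler_pM2l k_gt0) -(ler_pM2l k_gt0 (_ - _)); lra.
have q1 : mdist a' b' ^+ 2 - mdist a b ^+ 2 <= 2 * d * (2 * D).
  by apply: sqr_diff_le => //; lra.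
have q2 : mdist b' c' ^+ 2 - mdist b c ^+ 2 <= 2 * d * (2 * D).
  by apply: sqr_diff_le => //; lra.
have q3 : mdist a c ^+ 2 - mdist a' c' ^+ 2 <= 2 * d * (2 * D).
  by apply: sqr_diff_le => //; lra.
rewrite /bdf2_lagrangian /comp_0 /comp_m1 /comp_p1 /= tau2_k -/k.
have kM (u v : R) : u <= v -> k * u <= k * v by move=> ?; rewrite ler_pM2l.
move: (kM _ _ q1) (kM _ _ q2) (kM _ _ q3) EB de dk Eb'; clear.
lra.
Qed.

End Bdf2Estimates.

(** * Chains and curves *)

Section Chains.
Context {R : realType} {X : metricType R}.
Variables (E : R -> X -> R) (tau : R).

Definition chain_cost t (w : nat -> X) n : R :=
  \sum_(k < n) bdf2_lagrangian E tau t (mk3 (w k) (w k.+1) (w k.+2)).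

(** Here [w k] is [u (a - 1 + k)] and [n = b - a]. The sum over s from a to b + 1 has [n.+2] terms
    and reads the points up to [w n.+3]. *)
Definition chain_between (x1 x2 : X) n (w : nat -> X) : Prop :=
  [/\ w 0%N = x1, w 1%N = x1 & [/\ w n.+1 = x2, w n.+2 = x2 & w n.+3 = x2]].

Lemma chain_costS t w n : chain_cost t w n.+1 =
  chain_cost t w n + bdf2_lagrangian E tau t (mk3 (w n) (w n.+1) (w n.+2)).
Proof. by rewrite /chain_cost big_ord_recr. Qed.

Lemma chain_costD t w i m : chain_cost t w (i + m) =
  chain_cost t w i + chain_cost t (fun k => w (i + k)%N) m.
Proof.
elim: m => [|m IH]; first by rewrite addn0 /chain_cost big_ord0 addr0.
by rewrite addnS !chain_costS IH -[LHS]addrA !addnS.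
Qed.

Lemma eq_chain_cost t w w' n : (forall k, (k <= n.+1)%N -> w k = w' k) ->
  chain_cost t w n = chain_cost t w' n.
Proof.
move=> ww'; apply: eq_bigr => k _; have kn := ltn_ord k.
by rewrite !ww'//; lia.
Qed.

Lemma bdf2_action_inf t x1 x2 : bdf2_action E tau t x1 x2 =
  inf [set z | exists n w, chain_between x1 x2 n w /\ z = chain_cost t w n.+2].
Proof.
rewrite /bdf2_action; congr inf; apply/seteqP; split => z.
- move=> [a [b [u [ab [ua ub] [ua1 ub1 ub2] ->]]]].
  have [m mE] : exists m : nat, b = a + m%:Z.
    by exists `|(b - a)%R|%N; lia.
  exists m, (fun k => u (a - 1 + k%:Z)); split.
    rewrite /chain_between addr0 -ua1 -ub; split => //.
      by rewrite ua1 subrK.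
    split.
    + by rewrite mE; congr u; lia.
    + by rewrite ub -ub1 mE; congr u; lia.
    + by rewrite ub -ub2 mE; congr u; lia.
  rewrite /bdf2_chain_cost /int_sum /chain_cost.
  have -> : `|(b + 1 - (a - 1))%R|%N = m.+2 by rewrite mE; lia.
  apply: eq_bigr => k _; rewrite /bdf2_lagrangian /comp_0 /comp_m1 /comp_p1 /=.
  have -> : a - 1 + k.+1%:Z + 1 = a - 1 + k.+2%:Z by lia.
  have -> : a - 1 + k.+1%:Z - 1 = a - 1 + k%:Z by lia.
  set p := u _; set q := u _; set r := u _.
  rewrite (metric_sym r q) (metric_sym q p) (metric_sym r p); ring.
- move=> [n [w [[w0 w1 [wn1 wn2 wn3]] ->]]].
  have [u uE] : exists u : int -> X, forall s j, s + 1 = j%:Z -> u s = w j.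
    by exists (fun s => w `|(s + 1)%R|%N) => s j ->; rewrite absz_nat.
  exists 0, n%:Z, u; split => //.
  - by rewrite (uE 0 1%N)// (uE n%:Z n.+1)// -PoszD addn1.
  - by rewrite (uE _ 0%N)// (uE _ n.+2) ?(uE _ n.+3)//; lia.
  rewrite /bdf2_chain_cost /int_sum /chain_cost.
  have -> : `|(n%:Z + 1 - (0 - 1))%R|%N = n.+2 by lia.
  apply: eq_bigr => k _; rewrite /bdf2_lagrangian /comp_0 /comp_m1 /comp_p1.
  rewrite (uE (0 - 1 + k.+1%:Z) k.+1); last by lia.
  rewrite (uE (0 - 1 + k.+1%:Z + 1) k.+2); last by lia.
  rewrite (uE (0 - 1 + k.+1%:Z - 1) k); last by lia.
  set p := w _; set q := w _; set r := w _ => /=.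
  rewrite (metric_sym r q) (metric_sym q p) (metric_sym r p); ring.
Qed.

(** The compatibility of consecutive triples says that an admissible curve is a window of width
    three sliding along a sequence. The initial window is not charged, hence the costs of
    [w \o succn] below. *)
Definition seq_between (p q : triple X) n (w : nat -> X) : Prop :=
  mk3 (w 0%N) (w 1%N) (w 2%N) = p /\ mk3 (w n) (w n.+1) (w n.+2) = q.

Lemma curve_of_seq t p q n w : (0 < n)%N -> seq_between p q n w ->
  let gamma := fun s : int => mk3 (w `|s|%N) (w `|s|.+1) (w `|s|.+2) in
  bdf2_curves p q (0 : int) (n%:Z : int) gamma /\
  curve_cost (I := Zindex) (bdf2_lagrangian E tau t \o gamma) (0 : int) (n%:Z : int) =
    (chain_cost t (w \o succn) n)%:E.
Proof.
move=> n0 [wp wq] gamma; split.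
  split.
  - by rewrite ltz_nat.
  - exact: wp.
  - exact: wq.
  - move=> s /andP[s0 _]; rewrite /gamma /comp_p1 /comp_0 /comp_m1 /=.
    by have -> : `|(s + 1)%R|%N = `|s|.+1 by move: s0; rewrite /=; lia.
by rewrite /= /int_sum subr0 absz_nat; congr EFin; apply: eq_bigr.
Qed.

Lemma seq_of_curve t p q (a b : int) (gamma : int -> triple X) :
  bdf2_curves p q a b gamma -> exists n w, [/\ (0 < n)%N, seq_between p q n w
    & curve_cost (I := Zindex) (bdf2_lagrangian E tau t \o gamma) a b =
      (chain_cost t (w \o succn) n)%:E].
Proof.
move=> [ab ga gb gs].
have [m [m0 mE]] : exists m : nat, (0 < m)%N /\ b = a + m%:Z.
  by exists `|(b - a)%R|%N; move: ab => /=; lia.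
(* The left entries of the windows list the sequence; the last window contributes two more
   points. *)
pose w k := if (k <= m)%N then comp_m1 (gamma (a + k%:Z)) else
  if k == m.+1 then comp_0 (gamma b) else comp_p1 (gamma b).
have step k : (k < m)%N ->
    comp_p1 (gamma (a + k%:Z)) = comp_0 (gamma (a + k.+1%:Z)) /\
    comp_0 (gamma (a + k%:Z)) = comp_m1 (gamma (a + k.+1%:Z)).
  move=> km; have := gs (a + k%:Z).
  have -> : a + k%:Z + 1 = a + k.+1%:Z by lia.
  by apply; rewrite /= mE; lia.
have wE k : (k <= m)%N -> gamma (a + k%:Z) = mk3 (w k) (w k.+1) (w k.+2).
  move=> km; have e1 : comp_m1 (gamma (a + k%:Z)) = w k by rewrite /w km.
  have e2 : comp_0 (gamma (a + k%:Z)) = w k.+1.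
    rewrite /w; case: ifPn => [k1m|k1m]; first by rewrite (step k k1m).2.
    have -> : k = m by lia.
    by rewrite eqxx mE.
  have e3 : comp_p1 (gamma (a + k%:Z)) = w k.+2.
    rewrite /w; case: ifPn => [k2m|k2m].
      by rewrite (step k (ltnW k2m)).1 (step k.+1 k2m).2.
    case: ifPn => [/eqP [k1]|k1].
      have km' : (k < m)%N by lia.
      by rewrite (step k km').1 k1 mE.
    have -> : k = m by lia.
    by rewrite mE.
  by rewrite -e1 -e2 -e3; case: (gamma _) => [[? ?] ?].
exists m, w; split => //.
  by split; [rewrite -wE// addr0|rewrite -wE// -mE].
rewrite /= /int_sum /chain_cost; have -> : `|(b - a)%R|%N = m by rewrite mE; lia.
by congr EFin; apply: eq_bigr => k _ /=; rewrite -wE.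
Qed.

Lemma curve_action_inf t p q :
  curve_action (I := Zindex) (@bdf2_curves R X) (bdf2_lagrangian E tau) t p q =
  ereal_inf [set z | exists n w, [/\ (0 < n)%N, seq_between p q n w
    & z = (chain_cost t (w \o succn) n)%:E]].
Proof.
rewrite /curve_action; congr ereal_inf; apply/seteqP; split => z.
- move=> [a [b [gamma [/(seq_of_curve t)[n [w [n0 wpq ->]]] ->]]]].
  by exists n, w.
- move=> [n [w [n0 wpq ->]]].
  have [? <-] := curve_of_seq t n0 wpq.
  by exists (0 : int), n%:Z, (fun s : int => mk3 (w `|s|%N) (w `|s|.+1) (w `|s|.+2)).
Qed.

End Chains.

(** * The BDF2 action: lower semicontinuity and compatibility *)

Section Bdf2Action.
Context {R : realType} {X : metricType R}.
Variables (E : R -> X -> R) (T tau K0 C1 : R).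
Hypothesis tau0 : 0 < tau.
Hypothesis E_ge : forall t x, 0 <= t <= T -> 0 <= E t x + K0.
Hypothesis C10 : 0 < C1.
Hypothesis E_gronwall : forall s t x, 0 <= s <= T -> 0 <= t <= T ->
  E s x + K0 <= (E t x + K0) * expR (C1 * `|s - t|).
Hypothesis rE : regular_energy E T.

Notation Lag t a b c := (bdf2_lagrangian E tau t (mk3 a b c)).
Notation cost := (chain_cost E tau).

(** The one-sided modulus is applied twice with the roles exchanged; the margin in [M] lets the
    perturbed data satisfy the same bounds. *)
Lemma lagrangian_near t a b c e : 0 <= t <= T -> 0 < e ->
  exists2 d : R, 0 < d & forall t' a' b' c', 0 <= t' <= T ->
    `|t - t'| < d -> mdist a a' < d -> mdist b b' < d -> mdist c c' < d ->
    `|Lag t a b c - Lag t' a' b' c'| < e.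
Proof.
move=> tT e0.
pose M := `|E t b| + mdist a b + mdist b c + 10.
have dge0 (x y : X) : 0 <= mdist x y := mdist_ge0 x y.
have M0 : 0 <= M by rewrite /M !addr_ge0.
have e20 : 0 < e / 2 by rewrite divr_gt0.
have [d1 d10 hd1] := lagrangian_modulus tau0 E_ge C10 E_gronwall M0 e20.
have d1' : 0 < Num.min d1 1 by rewrite lt_min d10 ltr01.
have [d2 d20 hd2] := energy_near b rE tT d1'.
exists (Num.min (Num.min d1 1) d2); first by rewrite lt_min d1' d20.
move=> t' a' b' c' t'T; rewrite !lt_min => /andP[/andP[t1 _] t2].
move=> /andP[/andP[a1 a2] _] /andP[/andP[b1 b2] b3] /andP[/andP[c1 c2] _].
have := hd2 t' b' t'T t2 b3; rewrite lt_min => /andP[Eb1 Eb2].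
move: Eb1 Eb2; rewrite !ltr_norml => /andP[Eb1 Eb1'] /andP[Eb2 Eb2'].
have tri (x y z : X) : mdist x z <= mdist x y + mdist y z := metric_triangle x y z.
have sym (x y : X) : mdist x y = mdist y x := metric_sym x y.
have EM := ler_norm (E t b).
have ab' : mdist a' b' <= M.
  have := tri a' a b'; have := tri a b b'; rewrite (sym a' a) /M.
  have := dge0 b c; have := normr_ge0 (E t b); lra.
have bc' : mdist b' c' <= M.
  have := tri b' b c'; have := tri b c c'; rewrite (sym b' b) /M.
  have := dge0 a b; have := normr_ge0 (E t b); lra.
have := hd1 t t' a b c a' b' c' tT t'T t1 a1 b1 c1.
have := hd1 t' t a' b' c' a b c t'T tT.
rewrite (distrC t') (sym a') (sym b' b) (sym c') => /(_ t1 a1 b1 c1).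
have := dge0 a b; have := dge0 b c; have := normr_ge0 (E t b).
move=> n0 bc0 ab0.
move=> h1 h2; have {}h1 := h1 ltac:(rewrite /M; lra) ltac:(lra) ab' bc'.
have {}h2 := h2 ltac:(rewrite /M; lra) ltac:(lra) ltac:(rewrite /M; lra) ltac:(rewrite /M; lra).
lra.
Qed.

Section FixedTime.
Variable t : R.
Hypothesis tT : 0 <= t <= T.

Lemma chain_cost_ge0 w n : 0 <= cost t w n.
Proof. by apply: sumr_ge0 => k _; exact: (lagrangian_ge0 tau0 E_ge _ tT). Qed.

Lemma lagrangian_le_chain_cost w n k : (k < n)%N ->
  Lag t (w k) (w k.+1) (w k.+2) <= cost t w n.
Proof.
move=> kn; rewrite -(subnKC kn) chain_costD chain_costS.
have := chain_cost_ge0 w k.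
have := chain_cost_ge0 (fun j => w (k.+1 + j)%N) (n - k.+1); lra.
Qed.

Lemma chain_descent w n :
  E t (w 1%N) - E t (w n.+1) + (2 * tau)^-1 *
    (mdist (w 0%N) (w 1%N) ^+ 2 - mdist (w n) (w n.+1) ^+ 2) <= cost t w n.
Proof.
elim: n => [|n IH]; first by rewrite !subrr mulr0 addr0 /chain_cost big_ord0.
rewrite chain_costS.
have := energy_step_le tau0 E_ge (w n) (w n.+1) (w n.+2) tT; lra.
Qed.

(** The descent inequality on the tail of the chain: cost and end energy bound the energy of all
    earlier points, which places chains of bounded cost in compact sublevels. *)
Lemma chain_energy_le w n k : (k <= n)%N ->
  E t (w k.+1) <= E t (w n.+1) + (2 * tau)^-1 * mdist (w n) (w n.+1) ^+ 2
    + cost t w n.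
Proof.
move=> kn; have := chain_descent (fun j => w (k + j)%N) (n - k).
rewrite !addnS subnKC// addn0.
have := chain_costD E tau t w k (n - k); rewrite subnKC// => ->.
have := chain_cost_ge0 w k.
have : 0 <= (2 * tau)^-1 * mdist (w k) (w k.+1) ^+ 2.
  by rewrite mulr_ge0 ?sqr_ge0// invr_ge0 mulr_ge0// ltW.
lra.
Qed.

Lemma chain_dist_le w n k (M : R) : (k < n)%N -> 1 <= M ->
  4 * tau * cost t w n <= M -> mdist (w k) (w k.+1) <= M.
Proof.
move=> kn M1 hM; rewrite leNgt; apply/negP => h.
have := sqr_dist_le_lagrangian tau0 E_ge (w k) (w k.+1) (w k.+2) tT.
have : 4 * tau * Lag t (w k) (w k.+1) (w k.+2) <= 4 * tau * cost t w n.
  by rewrite ler_pM2l ?mulr_gt0//; exact: lagrangian_le_chain_cost.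
have : M < mdist (w k) (w k.+1) ^+ 2.
  rewrite expr2; apply: (@le_lt_trans _ _ (M * M)).
    by rewrite ler_pMr//; lra.
  by rewrite ltr_pM//; lra.
lra.
Qed.

Lemma chain_exists (x1 x2 : X) : chain_between x1 x2 1
  (fun k => if (k <= 1)%N then x1 else x2).
Proof. by []. Qed.

Implicit Types (x : X) (w : nat -> X).

Lemma bdf2_action_le x1 x2 n w : chain_between x1 x2 n w ->
  bdf2_action E tau t x1 x2 <= cost t w n.+2.
Proof.
move=> hw; rewrite bdf2_action_inf; apply: ge_inf; last by exists n, w.
by exists 0 => _ [m [v [_ ->]]]; exact: chain_cost_ge0.
Qed.

Lemma bdf2_action_ge x1 x2 z :
  (forall n w, chain_between x1 x2 n w -> z <= cost t w n.+2) ->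
  z <= bdf2_action E tau t x1 x2.
Proof.
move=> hz; rewrite bdf2_action_inf; apply: lb_le_inf.
  by eexists; eexists; eexists; split; [exact: chain_exists|].
by move=> _ [n [w [hw ->]]]; exact: hz.
Qed.

Lemma bdf2_action_ge0 x1 x2 : 0 <= bdf2_action E tau t x1 x2.
Proof. by apply: bdf2_action_ge => n w _; exact: chain_cost_ge0. Qed.

Lemma bdf2_action_near x1 x2 e : 0 < e -> exists n w,
  chain_between x1 x2 n w /\ cost t w n.+2 < bdf2_action E tau t x1 x2 + e.
Proof.
move=> e0; apply: contrapT => h.
have : bdf2_action E tau t x1 x2 + e <= bdf2_action E tau t x1 x2.
  apply: bdf2_action_ge => n w hw; rewrite leNgt; apply/negP => hc.
  by apply: h; exists n, w.
by rewrite -[leRHS]addr0 lerD2l leNgt e0.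
Qed.

Lemma energy_le_bdf2_action x1 x2 :
  E t x1 - E t x2 <= bdf2_action E tau t x1 x2.
Proof.
apply: bdf2_action_ge => n w [w0 w1 [w2 w3 w4]].
have := chain_descent w n.+2.
by rewrite w0 w1 w3 w4 !mdistxx subrr mulr0 addr0.
Qed.

Lemma chain_between_energy_le x1 x2 n w k :
  chain_between x1 x2 n w -> (k <= n.+2)%N ->
  E t (w k.+1) <= E t x2 + cost t w n.+2.
Proof.
move=> [_ _ [_ w2 w3]] kn; have := chain_energy_le w kn.
by rewrite w2 w3 mdistxx expr0n/= mulr0 addr0.
Qed.

(** Index [n.+1] keeps the copies of the start disjoint from those of the end, so replacing y by x
    alters exactly two terms. Energies and jumps along the chain are bounded in terms of M, and the
    uniform modulus makes d independent of the chain. *)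
Lemma chain_move_start x (M e : R) : 0 < e ->
  exists2 d : R, 0 < d & forall y z n w, mdist x y < d ->
    chain_between y z n.+1 w -> E t z <= M -> cost t w n.+3 <= M ->
    exists2 w', chain_between x z n.+1 w' &
      cost t w' n.+3 <= cost t w n.+3 + e.
Proof.
move=> e0.
pose N := 2 * `|M| + 4 * tau * `|M| + 1.
have N1 : 1 <= N.
  have := normr_ge0 M; have := mulr_ge0 (ltW tau0) (normr_ge0 M); rewrite /N; lra.
have MN : M + M <= N /\ 4 * tau * M <= N.
  have h1 := ler_norm M; have h2 : 4 * tau * M <= 4 * tau * `|M|.
    by rewrite ler_pM2l// mulr_gt0.
  have := normr_ge0 M; have := mulr_ge0 (ltW tau0) (normr_ge0 M).
  by rewrite /N; split; lra.
have e20 : 0 < e / 2 by rewrite divr_gt0.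
have [d1 d10 hd1] := lagrangian_modulus tau0 E_ge C10 E_gronwall (le_trans ler01 N1) e20.
have [d2 d20 hd2] := energy_near x rE tT d10.
exists (Num.min d1 d2); first by rewrite lt_min d10.
move=> y z n w; rewrite lt_min => /andP[xy1 xy2] hw zM cM.
have wE k : (k <= n.+3)%N -> E t (w k.+1) <= N.
  move=> kn; have := chain_between_energy_le hw kn; lra.
have wd k : (k < n.+3)%N -> mdist (w k) (w k.+1) <= N.
  move=> kn; apply: (chain_dist_le kn N1).
  apply: le_trans MN.2; rewrite ler_pM2l// mulr_gt0//.
have wN3 : w n.+3 = z by case: hw => [_ _ []].
have wN4 : w n.+4 = z by case: hw => [_ _ []].
case: hw => w0 w1 [w2 w3 w4].
pose w' k := if (k <= 1)%N then x else w k.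
exists w'; first by split.
have -> : n.+3 = (2 + n.+1)%N by [].
rewrite !chain_costD.
have -> : cost t (fun k => w' (2 + k)%N) n.+1 = cost t (fun k => w (2 + k)%N) n.+1.
  by apply: eq_chain_cost.
rewrite -addrA (addrC _ e) addrA lerD2r.
rewrite !chain_costS /chain_cost !big_ord0 !add0r.
have -> : e = e / 2 + e / 2 by rewrite -splitr.
have dxx (u : X) : mdist u u < d1 by rewrite mdistxx.
have yx : mdist y x < d1 by rewrite metric_sym.
have Exy : E t x <= E t y + d1.
  have := hd2 t y tT; rewrite subrr normr0 => /(_ d20 xy2).
  by rewrite ltr_norml; lra.
have tt : `|t - t| < d1 by rewrite subrr normr0.
have [E1 E2] := (wE 0%N isT, wE 1%N isT).
have [[D0 D1] D2] := (wd 0%N isT, wd 1%N isT, wd 2%N isT).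
move: E1 D0 D1; rewrite w0 w1 => E1 D0 D1.
have Lag0 : Lag t x x (w 2%N) <= Lag t y y (w 2%N) + e / 2 by apply: hd1.
have Lag1 : Lag t x (w 2%N) (w 3%N) <= Lag t y (w 2%N) (w 3%N) + e / 2.
  by apply: hd1 => //; rewrite lerDl ltW.
rewrite /w' /=; lra.
Qed.

(** Three terms contain the end point, hence [e / 3]. The energy bound is given at x and passes to y
    with a loss of 1. *)
Lemma chain_move_end x (M e : R) : 0 < e ->
  exists2 d : R, 0 < d & forall y z n w, mdist x y < d ->
    chain_between z y n.+1 w -> E t x <= M -> cost t w n.+3 <= M ->
    exists2 w', chain_between z x n.+1 w' &
      cost t w' n.+3 <= cost t w n.+3 + e.
Proof.
move=> e0.
pose N := 2 * `|M| + 4 * tau * `|M| + 2.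
have N1 : 1 <= N.
  have := normr_ge0 M; have := mulr_ge0 (ltW tau0) (normr_ge0 M); rewrite /N; lra.
have MN : M + M + 1 <= N /\ 4 * tau * M <= N.
  have h1 := ler_norm M; have h2 : 4 * tau * M <= 4 * tau * `|M|.
    by rewrite ler_pM2l// mulr_gt0.
  have := normr_ge0 M; have := mulr_ge0 (ltW tau0) (normr_ge0 M).
  by rewrite /N; split; lra.
have e30 : 0 < e / 3 by rewrite divr_gt0.
have [d1 d10 hd1] := lagrangian_modulus tau0 E_ge C10 E_gronwall (le_trans ler01 N1) e30.
have d1' : 0 < Num.min d1 1 by rewrite lt_min d10 ltr01.
have [d2 d20 hd2] := energy_near x rE tT d1'.
exists (Num.min d1 d2); first by rewrite lt_min d10.
move=> y z n w; rewrite lt_min => /andP[xy1 xy2] hw xM cM.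
have := hd2 t y tT; rewrite subrr normr0 => /(_ d20 xy2).
rewrite lt_min !ltr_norml => /andP[/andP[Exy1 Exy2] /andP[Exy3 Exy4]].
have wE k : (k <= n.+3)%N -> E t (w k.+1) <= N.
  move=> kn; have := chain_between_energy_le hw kn; lra.
have wd k : (k < n.+3)%N -> mdist (w k) (w k.+1) <= N.
  move=> kn; apply: (chain_dist_le kn N1).
  apply: le_trans MN.2; rewrite ler_pM2l// mulr_gt0//.
case: hw => w0 w1 [w2 w3 w4].
pose w' k := if (k <= n.+1)%N then w k else x.
have wle k : (k <= n.+1)%N -> w' k = w k by rewrite /w' => ->.
have wgt k : (n.+1 < k)%N -> w' k = x
  by move=> h; rewrite /w' leqNgt h.
have [e0' e1'] := (wle n (leqnSn n), wle n.+1 (leqnn _)).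
have e2' : w' n.+2 = x by apply: wgt.
have e3' : w' n.+3 = x by apply: wgt; apply: leqnSn.
have e4' : w' n.+4 = x by apply: wgt; rewrite ltnS ltnS ltnW.
exists w'.
  by split; [rewrite wle|rewrite wle|split].
rewrite !chain_costS.
have -> : cost t w' n = cost t w n.
  by apply: eq_chain_cost => k kn; rewrite wle.
rewrite e0' e1' e2' e3' e4' w2 w3 w4.
have yx : mdist y x < d1 by rewrite metric_sym.
have tt : `|t - t| < d1 by rewrite subrr normr0.
have dxx (u : X) : mdist u u < d1 by rewrite mdistxx.
have [[E1 E2] E3] := (wE n (leqW (leqW (leqnSn n))), wE n.+1 (leqW (leqnSn _)),
  wE n.+2 (leqnSn _)).
have [[D0 D1] D2] := (wd n (leqW (leqnSn _)), wd n.+1 (leqnSn _),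
  wd n.+2 (leqnn _)).
move: E2 E3 D1 D2; rewrite w2 w3 => E2 E3 D1 D2.
have h1 : Lag t (w n) (w n.+1) x <= Lag t (w n) (w n.+1) y + e / 3.
  by apply: hd1 => //; rewrite lerDl ltW.
have h2 : Lag t (w n.+1) x x <= Lag t (w n.+1) y y + e / 3.
  by apply: hd1 => //; lra.
have h3 : Lag t x x x <= Lag t y y y + e / 3.
  by apply: hd1 => //; lra.
lra.
Qed.

(** A chain between nearby points that costs less than [c0] is moved at both ends to x1 and x2,
    losing e each time; the gap [c0 - a = 4 * e] absorbs this. *)
Lemma bdf2_action_lsc : lower_semicontinuous
  (fun p : X * X => (bdf2_action E tau t p.1 p.2)%:E).
Proof.
move=> [x1 x2] a /=; rewrite lte_fin; set c0 := bdf2_action E tau t x1 x2 => ac.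
pose e := (c0 - a) / 4.
have e0 : 0 < e by rewrite divr_gt0 ?subr_gt0.
have e20 : 0 < e / 2 by rewrite divr_gt0.
have c00 : 0 <= c0 by exact: bdf2_action_ge0.
pose M := c0 + e + `|E t x2| + 1.
have EM := ler_norm (E t x2); have EM0 := normr_ge0 (E t x2).
have [d1 d10 hd1] := chain_move_start x1 M e0.
have [d2 d20 hd2] := chain_move_end x2 M e0.
have [d3 d30 hd3] := energy_near x2 rE tT ltr01.
have [d4 d40 hd4] := lagrangian_near x1 x1 x1 tT e0.
(* A chain with [n = 0] has equal ends and cannot be moved as above. Within d5 it occurs only if x1
   = x2, and then it consists of two diagonal terms. *)
have [d5 d50 hd5] : exists2 d5 : R, 0 < d5 &
    forall y, mdist x1 y < d5 -> mdist x2 y < d5 -> x1 = x2.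
  have [->|x12] := eqVneq x1 x2; first by exists 1.
  exists (mdist x1 x2 / 2); first by rewrite divr_gt0// mdist_gt0.
  move=> y h1 h2; exfalso.
  have := metric_triangle x1 y x2; rewrite (metric_sym y); lra.
pose d := Num.min (Num.min (Num.min d1 d2) (Num.min d3 d4)) d5.
have d0 : 0 < d by rewrite !lt_min d10 d20 d30 d40.
exists [set p | mdist x1 p.1 < d /\ mdist x2 p.2 < d].
  exists ([set y | mdist x1 y < d], [set y | mdist x2 y < d]).
    by split; apply/metricType_numDomainType.nbhs_mdistP; exists d.
  by move=> p [].
move=> [y1 y2] /= []; rewrite /d !lt_min.
move=> /andP[/andP[/andP[h11 h12] /andP[h13 h14]] h15].
move=> /andP[/andP[/andP[h21 h22] /andP[h23 h24]] h25].
rewrite lte_fin; apply: (@lt_le_trans _ _ (c0 - 2 * e)).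
  by rewrite /e; lra.
apply: bdf2_action_ge => n w hw.
have [big|small] := leP c0 (cost t w n.+2); first by lra.
case: n hw small => [|n] hw small.
  have y12 : y1 = y2 by case: hw => _ w1 [w2 _ _]; rewrite -w1.
  have x12 : x1 = x2 by apply: (hd5 y1) => //; rewrite y12.
  have := hd4 t y1 y1 y1 tT; rewrite subrr normr0 => /(_ d40 h14 h14 h14).
  rewrite ltr_norml => /andP[_ h].
  have hx : chain_between x1 x2 0 (fun=> x1) by split.
  have := bdf2_action_le hx; rewrite -/c0.
  rewrite !chain_costS /chain_cost !big_ord0 !add0r.
  case: hw => w0 w1 [_ w2 w3]; rewrite w0 w1 w2 w3 -y12; lra.
have := hd3 t y2 tT; rewrite subrr normr0 => /(_ d30 h23).
rewrite ltr_norml => /andP[Ey1 Ey2].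
have [w' hw' cw'] := hd1 y1 y2 n w h11 hw ltac:(rewrite /M; lra) ltac:(rewrite /M; lra).
have [w'' hw'' cw''] := hd2 y2 x1 n w' h22 hw' ltac:(rewrite /M; lra) ltac:(rewrite /M; lra).
have := bdf2_action_le hw''; rewrite -/c0; lra.
Qed.

End FixedTime.

Lemma bdf2_is_action : is_action E T (bdf2_action E tau).
Proof.
move=> t tT; split.
- by move=> x x'; exact: bdf2_action_ge0.
- exact: bdf2_action_lsc.
- by move=> x x'; exact: energy_le_bdf2_action.
Qed.

(** Along the BDF2 sequence the cost equals the energy loss minus a multiple of the squared last
    jump, hence is summable, and the jumps tend to 0. Stopping at a late index where the sequence is
    close to its cluster point and closing the chain there adds arbitrarily little. *)
Lemma bdf2_compatible omega : bdf2_transition_rule E tau T omega ->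
  compatible E T (bdf2_action E tau) omega.
Proof.
move=> hom t x tT; have [u [u0 umin] uom] := hom t x tT.
set om := omega t x.
apply/le_anti/andP; split; first exact: energy_le_bdf2_action.
apply/ler_addgt0Pr => e0 e00.
(* The three closing terms cost less than 3e, 3e and 2e, and the energies at [u N] and [om] differ
   by less than e. *)
pose e := e0 / 10; have e_gt0 : 0 < e by rewrite divr_gt0.
(* The predecessor makes [v 0 = v 1 = x], the doubled starting point of a chain. *)
pose v k := u k.-1.
have vcost N : E t x - E t (u N) =
    cost t v N + (2 * tau)^-1 * mdist (u N.-1) (u N) ^+ 2.
  elim: N => [|N IH].
    by rewrite u0 subrr /chain_cost big_ord0 mdistxx expr0n/= mulr0 addr0.
  have := energy_step_minimizer tau0 E_ge tT (umin N).
  rewrite chain_costS /v /=; lra.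
have [d d0 hd] := lagrangian_near om om om tT e_gt0.
have [dE dE0 hdE] := energy_near om rE tT e_gt0.
(* By [sqr_dist_le_lagrangian], a Lagrangian below the second entry forces a jump below [d / 2]. *)
pose s0 := Num.min e ((d / 2) ^+ 2 / (4 * tau)).
have s00 : 0 < s0 by rewrite lt_min e_gt0 divr_gt0 ?exprn_gt0 ?divr_gt0 ?mulr_gt0.
pose l k := Lag t (v k) (v k.+1) (v k.+2).
have lcvg : l k @[k --> \oo] --> 0.
  apply: cvg_series_cvg_0; apply: nondecreasing_is_cvgn.
    by apply: nondecreasing_series => k _ _; exact: (lagrangian_ge0 tau0 E_ge _ tT).
  exists (E t x + K0) => _ [N _ <-].
  have -> : series l N = cost t v N by rewrite /series/= big_mkord.
  have := vcost N; have := E_ge (u N) tT.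
  have : 0 <= (2 * tau)^-1 * mdist (u N.-1) (u N) ^+ 2.
    by rewrite mulr_ge0 ?sqr_ge0// invr_ge0 mulr_ge0// ltW.
  lra.
have [N0 _ hN0] := cvgr0_norm_lt _ lcvg _ s00.
have [N [NN0 omN1 omN2]] : exists N, [/\ (N0 <= N)%N, mdist om (u N) < d / 2
    & mdist om (u N) < dE].
  have A : (u @ \oo) [set y | exists2 N, (N0 <= N)%N & y = u N].
    by exists N0 => // N /= NN0; exists N.
  have B : nbhs om [set y | mdist om y < Num.min (d / 2) dE].
    apply/metricType_numDomainType.nbhs_mdistP; exists (Num.min (d / 2) dE) => //=.
    by rewrite lt_min dE0 divr_gt0.
  have [_ [[N NN0 ->] /=]] := uom _ _ A B.
  by rewrite lt_min => /andP[? ?]; exists N.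
have lsmall k : (N0 <= k)%N -> l k < e /\ mdist (u k.-1) (u k) < d / 2.
  move=> /hN0 /= h; have := le_lt_trans (ler_norm _) h.
  rewrite lt_min => /andP[le_ ld]; split => //.
  have := sqr_dist_le_lagrangian tau0 E_ge (v k) (v k.+1) (v k.+2) tT.
  move: ld; rewrite ltr_pdivlMr ?mulr_gt0// mulrC => ld /le_lt_trans/(_ ld).
  rewrite /v /= ltr_pXn2r// nnegrE ?mdist_ge0//.
  by rewrite divr_ge0// ltW.
have [lN dN] := lsmall N NN0.
have [_ dN1] := lsmall N.+1 (leqW NN0).
have tri (x y z : X) : mdist x z <= mdist x y + mdist y z := metric_triangle x y z.
have near_om y1 y2 y3 : mdist om y1 < d -> mdist om y2 < d -> mdist om y3 < d ->
    `|Lag t om om om - Lag t y1 y2 y3| < e.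
  by move=> *; apply: hd => //; rewrite subrr normr0.
have oN : mdist om (u N) < d by lra.
have oNp : mdist om (u N.-1) < d.
  by have := tri om (u N) (u N.-1); rewrite (metric_sym (u N)); lra.
have oNs : mdist om (u N.+1) < d by have := tri om (u N) (u N.+1); move: dN1 => /=; lra.
have oo : mdist om om < d by rewrite mdistxx.
have Lom : Lag t om om om < 2 * e.
  have := near_om _ _ _ oNp oN oNs; rewrite ltr_norml => /andP[_].
  by move: lN; rewrite /l /v /=; lra.
pose w k := if (k <= N.+1)%N then v k else om.
have wE k : (k <= N.+1)%N -> w k = v k by rewrite /w => ->.
have wo k : (N.+1 < k)%N -> w k = om
  by move=> h; rewrite /w leqNgt h.
have hw : chain_between x om N.+1 w.
  split; [by rewrite wE//= /v|by rewrite wE//= /v|].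
  split; [exact: wo|apply: wo; exact: leqW|apply: wo; exact: leqW (leqW _)].

apply: le_trans (bdf2_action_le tT hw) _.
rewrite !chain_costS.
have -> : cost t w N = cost t v N by apply: eq_chain_cost => k kN; exact: wE.
have [_ _ [w2 w3 w4]] := hw.
rewrite (wE N)// (wE N.+1)// w2 w3 w4.
have := near_om _ _ _ oNp oN oo; have := near_om _ _ _ oN oo oo.
rewrite !ltr_norml /v /= => /andP[h1 _] /andP[h2 _].
have := hdE t (u N) tT; rewrite subrr normr0 => /(_ dE0 omN2).
rewrite ltr_norml => /andP[_ h3].
have := vcost N.
have : 0 <= (2 * tau)^-1 * mdist (u N.-1) (u N) ^+ 2.
  by rewrite mulr_ge0 ?sqr_ge0// invr_ge0 mulr_ge0// ltW.
move: h1 h2 h3 Lom; rewrite /v /e; lra.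
Qed.

End Bdf2Action.

(** * Compactness of near-optimal curves *)

Section TripleTopology.
Context {R : realType} {X : metricType R}.
Implicit Types p q : triple X.

Lemma triple_mdistE p q : mdist p q = 3^-1 * (mdist (comp_m1 p) (comp_m1 q) +
  mdist (comp_0 p) (comp_0 q) + mdist (comp_p1 p) (comp_p1 q)).
Proof. by []. Qed.

Lemma mdist_comp_le p q : [/\ mdist (comp_m1 p) (comp_m1 q) <= 3 * mdist p q,
  mdist (comp_0 p) (comp_0 q) <= 3 * mdist p q
  & mdist (comp_p1 p) (comp_p1 q) <= 3 * mdist p q].
Proof.
rewrite triple_mdistE.
have h1 := mdist_ge0 (comp_m1 p) (comp_m1 q).
have h2 := mdist_ge0 (comp_0 p) (comp_0 q).
have h3 := mdist_ge0 (comp_p1 p) (comp_p1 q).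
by split; lra.
Qed.

Lemma lipschitz_continuous (Y Z : metricType R) (C : R) (f : Y -> Z) : 0 < C ->
  (forall y y', mdist (f y) (f y') <= C * mdist y y') -> continuous f.
Proof.
move=> C0 fC y; apply/metricType_numDomainType.cvgrPdist_lt => e e0.
apply/metricType_numDomainType.nbhs_mdistP; exists (e / C) => /=.
  by rewrite divr_gt0.
move=> y' /=; rewrite ltr_pdivlMr// mulrC => h.
exact: le_lt_trans (fC _ _) h.
Qed.

Lemma comp_m1_continuous : continuous (@comp_m1 X : triple X -> X).
Proof.
by apply: (@lipschitz_continuous _ _ 3) => // p q; case: (mdist_comp_le p q).
Qed.

Lemma comp_0_continuous : continuous (@comp_0 X : triple X -> X).
Proof.
by apply: (@lipschitz_continuous _ _ 3) => // p q; case: (mdist_comp_le p q).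
Qed.

Lemma comp_p1_continuous : continuous (@comp_p1 X : triple X -> X).
Proof.
by apply: (@lipschitz_continuous _ _ 3) => // p q; case: (mdist_comp_le p q).
Qed.

Lemma bdf2_immersion_continuous : continuous (@bdf2_immersion R X : X -> triple X).
Proof.
apply: (@lipschitz_continuous _ _ 1) => // x y.
by rewrite triple_mdistE /= mul1r; lra.
Qed.

Lemma bdf2_closed_immersion : closed_immersion (P := triple X) (@bdf2_immersion R X).
Proof.
split.
- by move=> x y [].
- exact: bdf2_immersion_continuous.
- move=> U oU; exists (@comp_0 X @^-1` U).
    by apply: open_comp => // p _; exact: comp_0_continuous.
  apply/seteqP; split => p.
    by move=> [x Ux <-]; split => //; exists x.
  by move=> [Up [x _ xp]]; exists x => //; move: Up; rewrite -xp.
- move=> p /= clp.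
  have h e : 0 < e -> mdist (comp_m1 p) (comp_0 p) <= 6 * e /\
      mdist (comp_0 p) (comp_p1 p) <= 6 * e.
    move=> e0; have nb : nbhs p [set q | mdist p q < e].
      by apply/metricType_numDomainType.nbhs_mdistP; exists e.
    have [_ [[x _ <-] /= xp]] := clp _ nb.
    have [h1 h2 h3] := mdist_comp_le p (bdf2_immersion x).
    move: h1 h2 h3; rewrite /bdf2_immersion /= => h1 h2 h3.
    have := metric_triangle (comp_m1 p) x (comp_0 p).
    have := metric_triangle (comp_0 p) x (comp_p1 p).
    rewrite (metric_sym x (comp_0 p)) (metric_sym x (comp_p1 p)); split; lra.
  have z (u v : X) : (forall e, 0 < e -> mdist u v <= 6 * e) -> u = v.
    move=> huv; apply: mdist_positivity; apply: le_anti; rewrite mdist_ge0 andbT.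
    apply/ler_addgt0Pr => e e0; rewrite add0r.
    have e60 : 0 < e / 6 by rewrite divr_gt0.
    by have := huv _ e60; rewrite mulrC divfK.
  have e1 := z _ _ (fun e e0 => (h e e0).1).
  have e2 := z _ _ (fun e e0 => (h e e0).2).
  exists (comp_0 p) => //; rewrite /bdf2_immersion -[in X in mk3 X]e1 [in X in mk3 _ _ X]e2.
  by case: p {clp h e1 e2} => [[]].
Qed.

(** The identity from the product topology to the averaged distance is continuous, so it carries the
    compact product over. *)
Lemma compact_triple (K : set X) : compact K ->
  compact [set p : triple X | [/\ K (comp_m1 p), K (comp_0 p) & K (comp_p1 p)]].
Proof.
move=> cK.
pose f (z : X * X * X) : triple X := z.
have -> : [set p : triple X | [/\ K (comp_m1 p), K (comp_0 p) & K (comp_p1 p)]] =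
    f @` ((K `*` K) `*` K).
  apply/seteqP; split => p.
    by move=> [K1 K2 K3]; exists p.
  by move=> [q [[K1 K2] K3] <-]; split.
apply: continuous_compact; last by do 2 apply: compact_setX => //.
apply: continuous_subspaceT => z.
apply/metricType_numDomainType.cvgrPdist_lt => e e0.
pose B x := [set y : X | mdist x y < e].
have nB x : nbhs x (B x) by apply/metricType_numDomainType.nbhs_mdistP; exists e.
exists (B z.1.1 `*` B z.1.2, B z.2).
  split; last exact: nB.
  by exists (B z.1.1, B z.1.2) => //; split; exact: nB.
move=> z' [[/= h1 h2] h3].
rewrite triple_mdistE /comp_m1 /comp_0 /comp_p1 /f; move: h1 h2 h3; rewrite /B /=; lra.
Qed.

Lemma bdf2_admissible_curves :
  admissible_curves (I := Zindex) (P := triple X) (@bdf2_curves R X).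
Proof.
split.
- move=> p1 p2 a b g g' [ab ga gb gs] gg'.
  have aI : a <= a <= b by rewrite lexx ltW.
  have bI : a <= b <= b by rewrite lexx ltW.
  split => //; [by rewrite -gg'|by rewrite -gg'|].
  move=> s /andP[as_ sb]; have [h1 h2] := gs s ltac:(by rewrite as_).
  have sI : a <= s <= b by rewrite as_/= (le_trans sb)// gerBl.
  have s1I : a <= s + 1 <= b by rewrite -lerBrDr sb andbT (le_trans as_)// lerDl.
  by rewrite -!gg'.
- by move=> p1 p2 a b g [].
- move=> p1 p2 p3 a s b g [ab ga gb gs] /andP[as_ sb] gsp; split; split => //.
  + move=> r /andP[ar rs]; apply: gs; rewrite ar /=.
    by rewrite (le_trans rs)// lerD2r ltW.
  + move=> r /andP[sr rb]; apply: gs; rewrite rb andbT.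
    by rewrite (le_trans (ltW as_)).
- move=> p1 p2 p3 a s b g g' [as_ ga gs hg] [sb g's g'b hg'].
  split.
  + exact: lt_trans sb.
  + by rewrite ltW.
  + by rewrite leNgt sb.
  + move=> r /andP[ar rb].
    have [rs|] := ltP r s.
      have rs1 : r + 1 <= s by move: rs; rewrite -lez1D addrC.
      by rewrite ltW// rs1; apply: hg; rewrite ar lerBrDr.
    (* Only the step leaving s mixes the two curves; their common value at s makes it a step of the
       second one. *)
    rewrite le_eqVlt => /orP[/eqP rs|sr].
      rewrite -rs lexx leNgt ltrDl ltr01 /= gs -g's.
      by apply: hg'; rewrite lexx rs.
    rewrite !leNgt sr (lt_trans sr) ?ltrDl//=.
    by apply: hg'; rewrite (ltW sr).
- move=> p1 p2 a b r g [ab ga gb gs]; split => //.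
  + by rewrite ltrD2r.
  + by rewrite subrK.
  + by rewrite subrK.
  + move=> s /andP[as_ sb]; rewrite (addrAC s 1 r); apply: gs.
    by rewrite -lerBlDr as_ /=; move: sb; rewrite -addrA (addrC (- r)) addrA lerBrDr.
Qed.

End TripleTopology.

Lemma compact_upper_bound (R : realType) (Y : topologicalType) (K : set Y) (f : Y -> R) :
  compact K -> continuous f -> exists B : R, forall y, K y -> f y <= B.
Proof.
move=> cK cf.
have /compact_bounded[B [_ hB]] : compact (f @` K).
  by apply: continuous_compact => //; exact: continuous_subspaceT.
exists (B + 1) => y Ky; apply: le_trans (ler_norm _) _.
by apply: (hB (B + 1)); [rewrite ltrDl|exists y].
Qed.

(** * The curve action, its relation to chains, and compactness *)

Section Bdf2Curves.
Context {R : realType} {X : metricType R}.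
Variables (E : R -> X -> R) (T tau K0 C1 : R).
Hypothesis tau0 : 0 < tau.
Hypothesis E_ge : forall t x, 0 <= t <= T -> 0 <= E t x + K0.
Hypothesis C10 : 0 < C1.
Hypothesis E_gronwall : forall s t x, 0 <= s <= T -> 0 <= t <= T ->
  E s x + K0 <= (E t x + K0) * expR (C1 * `|s - t|).
Hypothesis rE : regular_energy E T.
Implicit Types (t : R) (x y z : X) (w : nat -> X) (p q : triple X).

Notation Lag t a b c := (bdf2_lagrangian E tau t (mk3 a b c)).
Notation cost := (chain_cost E tau).
Notation action := (curve_action (I := Zindex) (@bdf2_curves R X)
  (bdf2_lagrangian E tau)).

Lemma lagrangian_continuous :
  {within [set q : triple X * R | 0 <= q.2 <= T],
    continuous (fun q : triple X * R => bdf2_lagrangian E tau q.2 q.1)}.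
Proof.
apply/subspace_continuousP => -[[[a b] c] t] /= tT.
apply/cvgrPdist_lt => e e0.
have [d d0 hd] := lagrangian_near tau0 E_ge C10 E_gronwall rE a b c tT e0.
rewrite /within /=.
exists ([set p | mdist (mk3 a b c) p < d / 3], [set s | `|t - s| < d]).
  split.
    apply/metricType_numDomainType.nbhs_mdistP; exists (d / 3) => //=.
    by rewrite divr_gt0.
  by apply/(@nbhs_ballP R R^o); exists d.
move=> [[[a' b'] c'] t'] /= [pd td] t'T.
have [h1 h2 h3] := mdist_comp_le (mk3 a b c) (mk3 a' b' c').
apply: hd => //; apply: le_lt_trans; [exact: h1| |exact: h2| |exact: h3|];
  by rewrite mulrC -ltr_pdivlMr.
Qed.

Lemma action_le t p q n w : (0 < n)%N -> seq_between p q n w ->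
  (action t p q <= (cost t (w \o succn) n)%:E)%E.
Proof.
by move=> n0 hw; rewrite curve_action_inf; apply: ereal_inf_lbound; exists n, w.
Qed.

Lemma action_ge t p q (r : R) :
  (forall n w, (0 < n)%N -> seq_between p q n w -> r <= cost t (w \o succn) n) ->
  (r%:E <= action t p q)%E.
Proof.
move=> h; rewrite curve_action_inf; apply: le_ereal_inf_tmp => _ [n [w [n0 hw ->]]].
by rewrite lee_fin; exact: h.
Qed.

Lemma action_ge0 t p q : 0 <= t <= T -> (0 <= action t p q)%E.
Proof.
by move=> tT; apply: action_ge => n w _ _; exact: (chain_cost_ge0 tau0 E_ge tT).
Qed.

(** Three shifts along a, b, c, a', b', c' replace the whole triple. This explicit curve makes the
    curve action finite, bounded over compact sets, and small near critical triples. *)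
Lemma action_le_three t (a b c a' b' c' : X) :
  (action t (mk3 a b c) (mk3 a' b' c') <=
    (Lag t b c a' + Lag t c a' b' + Lag t a' b' c')%:E)%E.
Proof.
pose w := nth a [:: a; b; c; a'; b'; c'].
have hw : seq_between (mk3 a b c) (mk3 a' b' c') 3 w by [].
have := action_le t (isT : (0 < 3)%N) hw.
by rewrite !chain_costS /chain_cost big_ord0 add0r.
Qed.

Lemma action_near t p q (e : R) : 0 <= t <= T -> 0 < e ->
  exists n w, [/\ (0 < n)%N, seq_between p q n w
    & ((cost t (w \o succn) n)%:E <= action t p q + e%:E)%E].
Proof.
move=> tT e0.
have fin : action t p q \is a fin_num.
  rewrite ge0_fin_numE ?action_ge0//.
  case: p q => [[a b] c] [[a' b'] c'].
  exact: le_lt_trans (action_le_three t a b c a' b' c') (ltey _).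
have : (action t p q < action t p q + e%:E)%E by rewrite lteDl// lte_fin.
rewrite {1}curve_action_inf => /ereal_inf_lt[_ [n [w [n0 hw ->]]] lt_].
by exists n, w; split => //; exact: ltW.
Qed.

(** The immersed start needs a third copy of x1; prepending it is free because the initial window is
    not charged. *)
Lemma seq_between_immersion t x1 x2 n w : chain_between x1 x2 n w ->
  exists2 v, seq_between (bdf2_immersion x1 : triple X) (bdf2_immersion x2) n.+2 v
    & cost t (v \o succn) n.+2 = cost t w n.+2.
Proof.
move=> [w0 w1 [w2 w3 w4]].
exists (fun k => if k is j.+1 then w j else x1) => //.
by split; rewrite /= ?w0 ?w1 ?w2 ?w3 ?w4.
Qed.

Lemma action_le_bdf2_action t x1 x2 : 0 <= t <= T ->
  (action t (bdf2_immersion x1) (bdf2_immersion x2)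
    <= (bdf2_action E tau t x1 x2)%:E)%E.
Proof.
move=> tT; apply/lee_addgt0Pr => e e0.
have [n [w [hw cw]]] := bdf2_action_near E tau t x1 x2 e0.
have [v hv vE] := seq_between_immersion t hw.
apply: le_trans (action_le t (ltn0Sn _) hv) _.
by rewrite vE -EFinD lee_fin ltW.
Qed.

(** A curve of a single step has overlapping end windows, which forces x1 = x2. Every longer curve
    becomes a chain of the same cost once its first point is dropped. *)
Lemma bdf2_action_eq_action t x1 x2 : 0 <= t <= T -> x1 <> x2 ->
  (bdf2_action E tau t x1 x2)%:E =
    action t (bdf2_immersion x1) (bdf2_immersion x2).
Proof.
move=> tT x12; apply/le_anti/andP; split; last exact: action_le_bdf2_action.
apply: action_ge => -[//|[|n]] w _ [[w0 w1 w2] [w3 w4 w5]].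
  by exfalso; apply: x12; rewrite -w1 w3.
apply: (bdf2_action_le tau0 E_ge tT); split => //.
Qed.

Lemma bdf2_action_diag t x : 0 <= t <= T -> Lag t x x x = 0 ->
  (bdf2_action E tau t x x)%:E = action t (bdf2_immersion x) (bdf2_immersion x).
Proof.
move=> tT Lx; have c0 : bdf2_action E tau t x x = 0.
  apply: le_anti; rewrite (bdf2_action_ge0 tau0 E_ge tT) andbT.
  have hw : chain_between x x 0 (fun=> x) by [].
  apply: le_trans (bdf2_action_le tau0 E_ge tT hw) _.
  by rewrite !chain_costS /chain_cost big_ord0 Lx !addr0.
apply/le_anti/andP; split; last exact: action_le_bdf2_action.
by rewrite c0; exact: action_ge0.
Qed.

Hypothesis csE : compact_sublevels E T.

(** Compactness is assumed for sublevels of the supremum over time; Gronwall bounds that supremum by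
    the energy at any single time. *)
Lemma energy_sublevel_compact (M : R) : exists2 K : set X, compact K &
  forall t y, 0 <= t <= T -> E t y <= M -> K y.
Proof.
pose C := (`|M| + `|K0|) * expR (C1 * T) + `|K0|.
exists [set y | (energy_sup E T y <= C%:E)%E]; first exact: csE.
move=> t y tT EM /=; apply: ge_ereal_sup => _ [s sT <-]; rewrite lee_fin.
have := E_gronwall y sT tT; have := E_ge y sT; have := E_ge y tT.
have h1 : expR (C1 * `|s - t|) <= expR (C1 * T).
  rewrite ler_expR ler_pM2l//; move: sT tT => /= /andP[? ?] /andP[? ?].
  by rewrite ler_norml; lra.
have e0 := expR_ge0 (C1 * T).
have n1 := ler_norm M; have n2 := ler_norm K0; have n3 := ler_norm (- K0).
rewrite normrN in n3.
move=> Et Es h2.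
have h3 : (E t y + K0) * expR (C1 * `|s - t|) <= (`|M| + `|K0|) * expR (C1 * T).
  by apply: ler_pM; [exact: Et|exact: expR_ge0|lra|exact: h1].
have h4 : 0 <= (`|M| + `|K0|) * expR (C1 * T).
  by rewrite mulr_ge0// addr_ge0.
by rewrite /C ler_norml; lra.
Qed.

(** The energy is bounded on K at time 0 by continuity, and Gronwall carries the bound to all times,
    so [B] does not depend on t. *)
Lemma compact_curve_bounds (K : set (triple X)) : 0 <= T -> compact K ->
  exists B : R, 0 <= B /\ forall t p q, 0 <= t <= T -> K p -> K q ->
    [/\ E t (comp_m1 p) <= B, E t (comp_0 p) <= B & E t (comp_p1 p) <= B] /\
    [/\ mdist (comp_m1 p) (comp_0 p) <= B, mdist (comp_0 p) (comp_p1 p) <= B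
      & mdist (comp_p1 p) (comp_m1 q) <= B].
Proof.
move=> T0 cK.
have [->|/set0P[p0 Kp0]] := eqVneq K set0; first by exists 0; split.
pose z := comp_0 p0.
have oT : 0 <= (0 : R) <= T by rewrite lexx.
have cE0 : continuous (E 0).
  move=> y; apply/cvgrPdist_lt => e e0.
  have [d d0 hd] := energy_near y rE oT e0.
  apply/metricType_numDomainType.nbhs_mdistP; exists d => // y' /= yy'.
  by apply: hd => //; rewrite subrr normr0.
have cz : continuous (fun y : X => mdist z y).
  move=> y; apply/cvgrPdist_lt => e e0.
  apply/metricType_numDomainType.nbhs_mdistP; exists e => // y' /= yy'.
  have := metric_triangle z y y'; have := metric_triangle z y' y.
  by rewrite (metric_sym y') ltr_norml; lra.
have bnd (c : triple X -> X) : continuous c -> exists B, forall p, K p ->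
    E 0 (c p) <= B /\ mdist z (c p) <= B.
  move=> cc.
  have [B1 hB1] : exists B, forall p, K p -> E 0 (c p) <= B.
    apply: compact_upper_bound cK _ => p.
    exact: (@continuous_comp _ _ _ c (E 0) p (cc p) (cE0 _)).
  have [B2 hB2] : exists B, forall p, K p -> mdist z (c p) <= B.
    apply: compact_upper_bound cK _ => p.
    exact: (@continuous_comp _ _ _ c (fun y => mdist z y) p (cc p) (cz _)).
  by exists (Num.max B1 B2) => p Kp; rewrite !le_max hB1// hB2// orbT.
have [B1 hB1] := bnd _ (@comp_m1_continuous R X).
have [B2 hB2] := bnd _ (@comp_0_continuous R X).
have [B3 hB3] := bnd _ (@comp_p1_continuous R X).
pose B := `|B1| + `|B2| + `|B3|.
have [n1 n2 n3] : [/\ B1 <= B, B2 <= B & B3 <= B].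
  have := ler_norm B1; have := ler_norm B2; have := ler_norm B3.
  have := normr_ge0 B1; have := normr_ge0 B2; have := normr_ge0 B3.
  by rewrite /B; split; lra.
have B0 : 0 <= B by rewrite /B !addr_ge0.
pose C := (B + `|K0|) * expR (C1 * T) + `|K0|.
have C0 : 0 <= C by rewrite /C !addr_ge0// mulr_ge0 ?addr_ge0// expR_ge0.
have EC t y : 0 <= t <= T -> E 0 y <= B -> E t y <= C.
  move=> tT Ey; have := E_gronwall y tT oT; rewrite subr0.
  have : (E 0 y + K0) * expR (C1 * `|t|) <= (B + `|K0|) * expR (C1 * T).
    apply: ler_pM; [exact: E_ge|exact: expR_ge0| |].
      by have := ler_norm K0; lra.
    rewrite ler_expR ler_pM2l//; move: tT => /andP[? ?].
    by rewrite ger0_norm.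
  have := ler_norm (- K0); rewrite normrN /C; lra.
have tri (u v : X) : mdist z u <= B -> mdist z v <= B -> mdist u v <= C + 2 * B.
  by have := metric_triangle u z v; rewrite (metric_sym u z); lra.
exists (C + 2 * B); split; first by lra.
move=> t p q tT Kp Kq.
have [[h1 h1'] [h2 h2'] [h3 h3']] := And3 (hB1 p Kp) (hB2 p Kp) (hB3 p Kp).
have [h4 h4'] := hB1 q Kq.
have [e1 e2 e3] : [/\ E t (comp_m1 p) <= C, E t (comp_0 p) <= C & E t (comp_p1 p) <= C].
  by split; apply: EC => //; lra.
by split; split; try lra; apply: tri; lra.
Qed.

Lemma bdf2_curves_compactness : 0 <= T -> forall K : set (triple X), compact K ->
  exists2 K' : set (triple X), compact K' &
    forall t p1 p2 (e : R), 0 <= t <= T -> K p1 -> K p2 -> 0 < e ->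
      exists a b gamma, [/\ @bdf2_curves R X p1 p2 a b gamma,
        forall s, a <= s <= b -> K' (gamma s)
        & (curve_cost (I := Zindex) (bdf2_lagrangian E tau t \o gamma) a b
            <= action t p1 p2 + e%:E)%E].
Proof.
move=> T0 K cK; have [B [B0 hB]] := compact_curve_bounds T0 cK.
(* [S] bounds each term of the three-step curve, so near-optimal curves cost at most [3 * S + 1];
   [M] adds to this the final energy and the final jump from [chain_energy_le]. *)
pose S := B + K0 + tau^-1 * (B ^+ 2 + B ^+ 2).
pose M := B + (2 * tau)^-1 * B ^+ 2 + (3 * S + 1).
have [K1 cK1 hK1] := energy_sublevel_compact M.
exists [set p : triple X | [/\ K1 (comp_m1 p), K1 (comp_0 p) & K1 (comp_p1 p)]].
  exact: compact_triple.
move=> t p q e tT Kp Kq e0.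
have [[Ep1 Ep2 Ep3] [dp1 dp2 dpq]] := hB t p q tT Kp Kq.
have [[Eq1 Eq2 Eq3] [dq1 dq2 _]] := hB t q q tT Kq Kq.
have Lle (a b c : X) : E t b <= B -> mdist a b <= B -> mdist b c <= B -> Lag t a b c <= S.
  move=> Eb ab bc; apply: le_trans (lagrangian_le tau0 E_ge a b c tT) _.
  by rewrite /S lerD ?lerD2r// ler_pM2l ?invr_gt0// lerD// !expr2 ler_pM// mdist_ge0.
have S3 : (action t p q <= (3 * S)%:E)%E.
  case: p q {Kp Kq} Ep1 Ep2 Ep3 dp1 dp2 dpq Eq1 Eq2 Eq3 dq1 dq2 => [[a b] c] [[a' b'] c'].
  rewrite /comp_m1 /comp_0 /comp_p1 /= => Ep1 Ep2 Ep3 dp1 dp2 dpq Eq1 Eq2 Eq3 dq1 dq2.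
  apply: le_trans (action_le_three t a b c a' b' c') _; rewrite lee_fin.
  have := Lle b c a' Ep3 dp2 dpq; have := Lle c a' b' Eq1 dpq dq1.
  have := Lle a' b' c' Eq2 dq1 dq2; lra.
(* Capping the tolerance at 1 keeps the compact set independent of e. *)
have e'0 : 0 < Num.min e 1 by rewrite lt_min e0 ltr01.
have [n [w [n0 hw cw]]] := action_near p q tT e'0.
have cwM : cost t (w \o succn) n <= 3 * S + 1.
  rewrite -lee_fin; apply: le_trans cw _; rewrite EFinD; apply: leeD => //.
  by rewrite lee_fin ge_min lexx orbT.
have [w012 wn] := hw.
have M_ge : B <= M.
  have h1 : 0 <= (2 * tau)^-1 * B ^+ 2.
    by rewrite mulr_ge0 ?sqr_ge0// invr_ge0 mulr_ge0// ltW.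
  have h2 : 0 <= cost t (w \o succn) n by exact: (chain_cost_ge0 tau0 E_ge tT).
  rewrite /M; lra.
(* Descent reaches the points from [w 2] on; the first two are entries of p itself. *)
have wE k : (k <= n.+2)%N -> E t (w k) <= M.
  case: k => [|[|k]] kn.
  - by apply: le_trans M_ge; move: Ep1; rewrite -w012.
  - by apply: le_trans M_ge; move: Ep2; rewrite -w012.
  - have := chain_energy_le tau0 E_ge tT (w \o succn) (kn : (k <= n)%N) => /= h.
    apply: le_trans h _; rewrite /M; apply: lerD => //; apply: lerD.
      by move: Eq3; rewrite -wn.
    rewrite ler_pM2l ?invr_gt0 ?mulr_gt0// !expr2.
    by move: dq2; rewrite -wn => ?; rewrite ler_pM// mdist_ge0.
have [gcurve gcost] := curve_of_seq E tau t n0 hw.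
exists 0, n%:Z, (fun s : int => mk3 (w `|s|%N) (w `|s|.+1) (w `|s|.+2)).
split => //.
- move=> s /andP[s0 sn] /=.
  have sn' : (`|s| <= n)%N by rewrite -lez_nat gez0_abs.
  by split; apply: hK1 tT _; apply: wE; rewrite ?ltnS// ltnW// ltnS ltnW.
- rewrite gcost; apply: le_trans cw _; apply: leeD => //.
  by rewrite lee_fin ge_min lexx.
Qed.

End Bdf2Curves.

(** * Zeros of the Lagrangian and of the action *)

Section Bdf2Zeros.
Context {R : realType} {X : metricType R}.
Variables (E : R -> X -> R) (T tau K0 C1 L : R).
Hypothesis tau0 : 0 < tau.
Hypothesis E_ge : forall t x, 0 <= t <= T -> 0 <= E t x + K0.
Hypothesis C10 : 0 < C1.
Hypothesis E_gronwall : forall s t x, 0 <= s <= T -> 0 <= t <= T ->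
  E s x + K0 <= (E t x + K0) * expR (C1 * `|s - t|).
Hypothesis rE : regular_energy E T.
Hypothesis pX : path_space X.
Hypothesis L0 : 0 < L.
Hypothesis lipE : slope_lipschitz E T L.
Hypothesis tauL : tau <= L^-1.
Implicit Types (t : R) (x y z : X) (w : nat -> X) (p q : triple X).

Notation Lag t a b c := (bdf2_lagrangian E tau t (mk3 a b c)).
Notation cost := (chain_cost E tau).
Notation action := (curve_action (I := Zindex) (@bdf2_curves R X)
  (bdf2_lagrangian E tau)).

(** This is where [tau <= L^-1] enters. With s = d(x, y) and r = d(x', x), quadratic growth costs at
    most s^2 / (2 tau), and s^2 / (2 tau) - (s + r)^2 / (4 tau) = ((s - r)^2 - 2 r^2) / (4 tau). *)
Lemma critical_energy_gap t x x' : 0 <= t <= T -> slope E t x = 0%E ->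
  E t x - bdf2_energy E tau t x x' <= (2 * tau)^-1 * mdist x' x ^+ 2.
Proof.
move=> tT sx.
suff : E t x - (2 * tau)^-1 * mdist x' x ^+ 2 <= bdf2_energy E tau t x x' by lra.
apply: bdf2_energy_ge => y.
have hg := critical_quadratic_growth y pX rE lipE L0 tT sx.
have Ltau : L <= tau^-1 by rewrite -[L]invrK lef_pV2 ?posrE ?invr_gt0.
have k0 : 0 < (4 * tau)^-1 by rewrite invr_gt0 mulr_gt0.
have k1 : tau^-1 = 4 * (4 * tau)^-1 by rewrite invfM mulrA divff ?mul1r.
have k2 : (2 * tau)^-1 = 2 * (4 * tau)^-1 by field; rewrite gt_eqF.
have hL : L / 2 * mdist x y ^+ 2 <= tau^-1 / 2 * mdist x y ^+ 2.
  by rewrite ler_wpM2r ?sqr_ge0// ler_pM2r.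
have tri : mdist y x' ^+ 2 <= (mdist x y + mdist x' x) ^+ 2.
  have := metric_triangle y x x'; rewrite (metric_sym y x) (metric_sym x x') => h.
  by rewrite !expr2 ler_pM ?mdist_ge0.
have sq := sqr_ge0 (mdist x y - mdist x' x).
rewrite /bdf2_functional (metric_sym y x).
move: tri sq hL; rewrite -(ler_pM2l k0) -(ler_pM2l k0 0) mulr0 k1 k2.
move: hg; lra.
Qed.

(* Second order in the jumps: the cost of a fine chain of critical points is at
   most its mesh times its length. *)
Lemma lagrangian_critical_le t a b c : 0 <= t <= T -> slope E t b = 0%E ->
  Lag t a b c <= tau^-1 * (mdist a b ^+ 2 + mdist b c ^+ 2).
Proof.
move=> tT sb; have := critical_energy_gap a tT sb.
rewrite /bdf2_lagrangian /comp_0 /comp_m1 /comp_p1 /=.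
have k1 : tau^-1 = 2 * (2 * tau)^-1 by rewrite invfM mulrA divff ?mul1r.
have : 0 <= (4 * tau)^-1 * mdist a c ^+ 2.
  by rewrite mulr_ge0 ?sqr_ge0// invr_ge0 mulr_ge0// ltW.
have : 0 <= (2 * tau)^-1 * mdist b c ^+ 2.
  by rewrite mulr_ge0 ?sqr_ge0// invr_ge0 mulr_ge0// ltW.
rewrite k1; lra.
Qed.

Lemma critical_lagrangian_eq0 t x : 0 <= t <= T -> slope E t x = 0%E ->
  Lag t x x x = 0.
Proof.
move=> tT sx; apply: le_anti; rewrite (lagrangian_ge0 tau0 E_ge _ tT) andbT.
by have := lagrangian_critical_le x x tT sx; rewrite mdistxx expr0n/= addr0 mulr0.
Qed.

Lemma lagrangian_diag t x :
  Lag t x x x = E t x - bdf2_energy E tau t x x.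
Proof.
rewrite /bdf2_lagrangian /comp_0 /comp_m1 /comp_p1 /= mdistxx expr0n/=; ring.
Qed.

(** Then x minimizes its own BDF2 functional, so E drops at most quadratically away from x. *)
Lemma lagrangian_diag_eq0 t x : 0 <= t <= T -> Lag t x x x <= 0 ->
  slope E t x = 0%E.
Proof.
move=> tT; rewrite lagrangian_diag => h.
have C0 : 0 < tau^-1 by rewrite invr_gt0.
apply: (slope_eq0 C0) => y.
have := bdf2_energy_le tau0 E_ge x x y tT.
have : 0 <= (4 * tau)^-1 * mdist y x ^+ 2.
  by rewrite mulr_ge0 ?sqr_ge0// invr_ge0 mulr_ge0// ltW.
rewrite /bdf2_functional (metric_sym y x); lra.
Qed.

Lemma lagrangian_eq0 t p : 0 <= t <= T ->
  bdf2_lagrangian E tau t p = 0 <->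
  exists2 x, p = bdf2_immersion x & slope E t x = 0%E.
Proof.
move=> tT; split; last first.
  by move=> [x -> sx]; exact: critical_lagrangian_eq0.
case: p => [[a b] c] Lp.
have := lagrangian_ge tau0 E_ge a b c tT.
rewrite [X in _ <= X]Lp pmulr_rle0 ?invr_gt0 ?mulr_gt0// => h.
have s1 := sqr_ge0 (mdist a b); have s2 := sqr_ge0 (mdist a b - mdist b c).
have ab0 : mdist a b = 0 by apply/eqP; rewrite -sqrf_eq0; apply/eqP; lra.
have bc0 : mdist b c = 0.
  have : mdist a b - mdist b c = 0 by apply/eqP; rewrite -sqrf_eq0; apply/eqP; lra.
  by rewrite ab0; lra.
have ab := mdist_positivity _ _ ab0; have bc := mdist_positivity _ _ bc0.
exists b; first by rewrite /bdf2_immersion /mk3 -bc ab.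
apply: lagrangian_diag_eq0 => //.
by move: Lp; rewrite -bc ab => Lp; rewrite [leLHS]Lp.
Qed.

Lemma compact_seq_cluster (Y : metricType R) (K : set Y) (u : nat -> Y) :
  compact K -> (forall n, K (u n)) -> exists2 y, K y &
    forall (e : R) N, 0 < e -> exists2 n, (N <= n)%N & mdist y (u n) < e.
Proof.
move=> cK uK; have [|y [Ky yu]] := cK (u @ \oo) _.
  by exists 0%N => // n _; exact: uK.
exists y => // e N e0.
have A : (u @ \oo) [set z | exists2 n, (N <= n)%N & z = u n].
  by exists N => // n /= Nn; exists n.
have B : nbhs y [set z | mdist y z < e].
  by apply/metricType_numDomainType.nbhs_mdistP; exists e.
by have [_ [[n Nn ->] /= h]] := yu _ _ A B; exists n.
Qed.

(** Counterexamples with both tolerances tending to 0 would cluster at a zero of the Lagrangian,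
    that is at a critical triple (z, z, z). There the three terms of the explicit connecting curve
    are small by continuity. *)
Lemma bdf2_local_control t (K : set (triple X)) (e : R) : 0 <= t <= T ->
  compact K -> 0 < e -> exists L' Pm : R, [/\ 0 < L', 0 < Pm &
    forall p1 p2, K p1 -> K p2 ->
      bdf2_lagrangian E tau t p1 <= Pm -> bdf2_lagrangian E tau t p2 <= Pm ->
      mdist p1 p2 <= L' -> (action t p1 p2 <= e%:E)%E].
Proof.
move=> tT cK e0; apply: contrapT => hn.
have /choice[pq hpq] : forall n : nat, exists pq : triple X * triple X,
    [/\ K pq.1, bdf2_lagrangian E tau t pq.1 <= harmonic n,
      mdist pq.1 pq.2 <= harmonic n & ~ (action t pq.1 pq.2 <= e%:E)%E].
  move=> n; apply: contrapT => h; apply: hn; exists (harmonic n), (harmonic n).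
  split; [exact: harmonic_gt0|exact: harmonic_gt0|].
  move=> p1 p2 Kp1 Kp2 L1 L2 d12; apply: contrapT => hp; apply: h.
  by exists (p1, p2); split.
have pqK n : K (pq n).1 by case: (hpq n).
have [p Kp pcl] := compact_seq_cluster cK pqK.
have small (d : R) : 0 < d -> exists N, forall n, (N <= n)%N -> harmonic n < d.
  move=> d0; have [N _ hN] := cvgr0_norm_lt _ (@cvg_harmonic R) _ d0.
  exists N => n /hN /=; exact: le_lt_trans (ler_norm _).
case: p Kp pcl => [[a b] c] Kp pcl.
have near_p (a1 b1 c1 : X) (d : R) : 0 < d -> exists n,
    [/\ harmonic n < d, mdist a (comp_m1 (pq n).1) < d,
      mdist b (comp_0 (pq n).1) < d & mdist c (comp_p1 (pq n).1) < d].
  move=> d0; have [N hN] := small d d0.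
  have d30 : 0 < d / 3 by rewrite divr_gt0.
  have [n Nn hn'] := pcl _ N d30; exists n.
  have [h1 h2 h3] := mdist_comp_le (mk3 a b c) (pq n).1.
  move: h1 h2 h3; rewrite /= => h1 h2 h3; move: (hN n Nn) => ?.
  have hn3 : 3 * mdist (mk3 a b c) (pq n).1 < d.
    by rewrite mulrC -ltr_pdivlMr.
  by split => //; [exact: le_lt_trans h1 _|exact: le_lt_trans h2 _|exact: le_lt_trans h3 _].
have Lp : bdf2_lagrangian E tau t (mk3 a b c) = 0.
  apply: le_anti; rewrite (lagrangian_ge0 tau0 E_ge _ tT) andbT.
  apply/ler_addgt0Pr => r r0; rewrite add0r.
  have r20 : 0 < r / 2 by rewrite divr_gt0.
  have [d d0 hd] := lagrangian_near tau0 E_ge C10 E_gronwall rE a b c tT r20.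
  have d'0 : 0 < Num.min d (r / 2) by rewrite lt_min d0.
  have [n []] := near_p a b c _ d'0; rewrite !lt_min.
  move=> /andP[_ hr] /andP[ha _] /andP[hb _] /andP[hc _].
  have := hd t _ _ _ tT; rewrite subrr normr0 => /(_ _ _ _ d0 ha hb hc).
  have [_ Ln _ _] := hpq n.
  have -> : mk3 (comp_m1 (pq n).1) (comp_0 (pq n).1) (comp_p1 (pq n).1) = (pq n).1.
    by case: (pq n).1 => [[]].
  by rewrite ltr_norml; lra.
have /lagrangian_eq0 : bdf2_lagrangian E tau t (mk3 a b c) = 0 := Lp.
move=> /(_ tT)[z]; rewrite /bdf2_immersion => -[az bz cz] sz.
have Lz : Lag t z z z = 0 by move: Lp; rewrite az bz cz.
have e40 : 0 < e / 4 by rewrite divr_gt0.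
have [d d0 hd] := lagrangian_near tau0 E_ge C10 E_gronwall rE z z z tT e40.
(* An averaged distance below [d / 4] allows components to differ by up to [3 * d / 4], and the
   first triple is within [d / 4] of z. *)
have d40 : 0 < d / 4 by rewrite divr_gt0.
have [n [hr ha hb hc]] := near_p a b c _ d40.
have [_ _ d12 nact] := hpq n; apply: nact.
have [h1 h2 h3] := mdist_comp_le (pq n).1 (pq n).2.
case: (pq n) ha hb hc d12 h1 h2 h3 => [[[a1 b1] c1] [[a2 b2] c2]] /=.
rewrite /comp_m1 /comp_0 /comp_p1 /= az bz cz => ha hb hc d12 h1 h2 h3.
have {}d12 := le_lt_trans d12 hr.
have tri u v : mdist z v <= mdist z u + mdist u v := metric_triangle z u v.
have zb1 : mdist z b1 < d by lra.
have zc1 : mdist z c1 < d by lra.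
have za2 : mdist z a2 < d by have := tri a1 a2; lra.
have zb2 : mdist z b2 < d by have := tri b1 b2; lra.
have zc2 : mdist z c2 < d by have := tri c1 c2; lra.
have small_lag u1 u2 u3 : mdist z u1 < d -> mdist z u2 < d -> mdist z u3 < d ->
    Lag t u1 u2 u3 < e / 4.
  move=> k1 k2 k3; have := hd t u1 u2 u3 tT; rewrite subrr normr0.
  by move=> /(_ d0 k1 k2 k3); rewrite Lz sub0r normrN; apply: le_lt_trans (ler_norm _).
apply: le_trans (action_le_three E tau t a1 b1 c1 a2 b2 c2) _.
have := small_lag _ _ _ zb1 zc1 za2; have := small_lag _ _ _ zc1 za2 zb2.
have := small_lag _ _ _ za2 zb2 zc2; rewrite lee_fin; lra.
Qed.

End Bdf2Zeros.

(** * Vanishing action and connected components of the critical set *)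

Lemma fine_partition (R : realType) (X : metricType R) (eta : R -> X) (d : R) :
  continuous (fun u => eta (clamp01 u)) -> 0 < d ->
  exists N, forall i, (i <= N)%N ->
    mdist (eta (clamp01 (i%:R / N.+1%:R))) (eta (clamp01 (i.+1%:R / N.+1%:R))) < d.
Proof.
move=> ceta d0; apply: contrapT => hn.
have /choice[f hf] : forall N, exists i, (i <= N)%N /\
    d <= mdist (eta (clamp01 (i%:R / N.+1%:R))) (eta (clamp01 (i.+1%:R / N.+1%:R))).
  move=> N; apply: contrapT => h; apply: hn; exists N => i iN.
  by rewrite ltNge; apply/negP => hi; apply: h; exists i.
(* Left ends of the bad subintervals: near a cluster point of them, both ends of some bad
   subinterval are mapped within [d / 2] of the same point. *)
pose s N : R^o := (f N)%:R / N.+1%:R.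
have sK N : `[0, 1]%classic (s N).
  rewrite /= in_itv/= /s divr_ge0//= ler_pdivrMr// mul1r ler_nat.
  by rewrite leqW// (hf N).1.
have [u _ hu] := @compact_seq_cluster R R^o _ s (@segment_compact R 0 1) sK.
have d20 : 0 < d / 2 by rewrite divr_gt0.
have /metricType_numDomainType.cvgrPdist_lt/(_ _ d20) := ceta u.
move=> /(@nbhs_ballP R R^o)[e /= e0 he].
have e20 : 0 < e / 2 by rewrite divr_gt0.
have [N1 _ hN1] := cvgr0_norm_lt _ (@cvg_harmonic R) _ e20.
have [N NN1 uN] := hu _ N1 e20.
have := (hf N).2; apply/negP; rewrite -ltNge.
have h1 : `|u - s N| < e / 2 by rewrite distrC; exact: uN.
have h2 := hN1 N NN1; rewrite /= gtr0_norm ?invr_gt0// in h2.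
have e1 : (f N).+1%:R / N.+1%:R = s N + N.+1%:R^-1.
  by rewrite /s -addn1 natrD mulrDl mul1r.
have h3 : `|u - s N| < e by lra.
have h5 : `|u - (s N + N.+1%:R^-1)| < e.
  have := ler_normB (u - s N) (N.+1%:R^-1).
  rewrite -addrA -opprD (@gtr0_norm _ (N.+1%:R^-1)) ?invr_gt0// => h4.
  by apply: le_lt_trans h4 _; rewrite [ltRHS](splitr e) ltrD.
rewrite e1 -/(s N); apply: le_lt_trans (metric_triangle _ (eta (clamp01 u)) _) _.
by rewrite [ltRHS](splitr d) ltrD//; [rewrite metric_sym; exact: he|exact: he].
Qed.

Section Bdf2Components.
Context {R : realType} {X : metricType R}.
Variables (E : R -> X -> R) (T tau K0 L : R).
Hypothesis tau0 : 0 < tau.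
Hypothesis E_ge : forall t x, 0 <= t <= T -> 0 <= E t x + K0.
Hypothesis rE : regular_energy E T.
Hypothesis pX : path_space X.
Hypothesis L0 : 0 < L.
Hypothesis lipE : slope_lipschitz E T L.
Hypothesis tauL : tau <= L^-1.
Implicit Types (t : R) (x y z : X).

Notation Lag t a b c := (bdf2_lagrangian E tau t (mk3 a b c)).
Notation cost := (chain_cost E tau).

Lemma critical_path_action_eq0 t x1 x2 (eta : R -> X) : 0 <= t <= T ->
  path_in (Crit E t) x1 x2 eta -> rectifiable eta ->
  bdf2_action E tau t x1 x2 = 0.
Proof.
move=> tT [ceta eta0 eta1 etaC] [M hM].
have {}ceta := continuous_clamp01 ceta.
have c0 := bdf2_action_ge0 tau0 E_ge tT x1 x2.
pose M1 := `|M| + 1.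
have M10 : 0 < M1 by rewrite ltr_wpDl.
apply/le_anti; rewrite c0 andbT; apply/ler_addgt0Pr => e e0; rewrite add0r.
(* The total cost is at most [tau^-1] times the mesh d times twice the length bound [M1], since each
   jump occurs in two terms. *)
pose d := e * tau / (2 * M1).
have d0 : 0 < d by rewrite divr_gt0 ?mulr_gt0.
have [N hN] := fine_partition ceta d0.
pose s (j : nat) : R := j%:R / N.+1%:R.
have sI j : (j <= N.+1)%N -> 0 <= s j <= 1.
  by move=> jN; rewrite /s divr_ge0//= ler_pdivrMr// mul1r ler_nat.
have s1 j : (N < j)%N -> clamp01 (s j) = 1.
  move=> Nj; rewrite /clamp01 min_l ?max_r//.
  by rewrite /s ler_pdivlMr// mul1r ler_nat.
pose v j := eta (clamp01 (s j)).
pose w k := if k is j.+1 then v j else x1.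
have v0 : v 0%N = x1 by rewrite /v clamp01_id ?sI// /s mul0r.
have v1 j : (N < j)%N -> v j = x2 by move=> Nj; rewrite /v s1.
have hw : chain_between x1 x2 N.+1 w.
  by split; rewrite /w ?v0//; split; rewrite v1// ltnS; exact: leqW.
have wC k : slope E t (w k) = 0%E.
  case: k => [|j]; last by apply: etaC; exact: clamp01_itv.
  by rewrite /w -eta0; apply: etaC; rewrite lexx ler01.
pose D k := mdist (w k) (w k.+1).
have D0 k : 0 <= D k by exact: mdist_ge0.
have Dd k : D k <= d.
  rewrite /D /w; case: k => [|j]; first by rewrite v0 mdistxx ltW.
  have [jN|Nj] := leqP j N; first by rewrite ltW// hN.
  by rewrite !v1 ?mdistxx ?(ltW d0)// leqW.
have sqD k : D k * D k <= d * D k by rewrite ler_wpM2r.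
(* These are the jumps over the uniform partition, bounded by rectifiability, followed by zeros once
   the clamp holds the curve at x2. *)
have sumD n : \sum_(k < n) D k.+1 <= M1.
  pose S := [seq s j.+1 | j <- iota 0 N.+1].
  have nthS j : (j <= N.+1)%N -> nth 1 (0 :: S) j = s j.
    case: j => [|j] jN; first by rewrite /s mul0r.
    by rewrite /= /S (nth_map 0%N) ?size_iota// nth_iota.
  have Spart : itv_partition 0 1 S.
    split; last first.
      rewrite (last_nth 1) size_map size_iota nthS// /s divff//.
    apply/(pathP 1) => j; rewrite size_map size_iota => jN.
    rewrite nthS; last by rewrite ltnW.
    have -> : nth 1 S j = s j.+1 by rewrite -(nthS j.+1).
    by rewrite /s ltr_pM2r ?invr_gt0// ltr_nat.
  have := hM S Spart; rewrite /= size_map size_iota => hS.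
  have hS' : \sum_(k < N.+1) D k.+1 <= M.
    apply: le_trans hS; rewrite big_mkord; apply: ler_sum => k _.
    have kN := ltn_ord k.
    have c1 : clamp01 (s k) = s k by apply: clamp01_id; apply: sI; exact: ltnW.
    have c2 : clamp01 (s k.+1) = s k.+1 by apply: clamp01_id; exact: sI.
    have n1 := nthS k (ltnW kN); have n2 := nthS k.+1 kN.
    by rewrite /D /w /v c1 c2 -n1 -n2.
  have [nN|Nn] := leqP n N.+1.
    apply: (@le_trans _ _ M); last by rewrite /M1 ler_wpDr// ler_norm.
    apply: le_trans hS'; rewrite -(subnKC nN) big_split_ord /= lerDl.
    by apply: sumr_ge0 => k _.
  rewrite -(subnKC (ltnW Nn)) big_split_ord /=.
  rewrite [X in _ + X]big1 ?addr0; last first.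
    move=> k _; rewrite /D /w !v1 ?mdistxx//; rewrite ?addSn ltnS ?leq_addr//.
    by rewrite leqW// leq_addr.
  by apply: le_trans hS' _; rewrite /M1 ler_wpDr// ler_norm.
have sumD0 n : \sum_(k < n) D k <= M1.
  case: n => [|n]; first by rewrite big_ord0 ltW.
  by rewrite big_ord_recl {1}/D /w v0 mdistxx add0r; exact: sumD.
apply: le_trans (bdf2_action_le tau0 E_ge tT hw) _.
apply: (@le_trans _ _ (\sum_(k < N.+3) (tau^-1 * (d * D k) + tau^-1 * (d * D k.+1)))).
  apply: ler_sum => k _.
  apply: le_trans (lagrangian_critical_le tau0 rE pX L0 lipE tauL _ _ tT (wC _)) _.
  rewrite -mulrDr ler_pM2l ?invr_gt0// !expr2; apply: lerD.
  - exact: (sqD k).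
  - exact: (sqD k.+1).
rewrite big_split /= -!mulr_sumr -mulrDr -mulrDr.
apply: (@le_trans _ _ (tau^-1 * (d * (M1 + M1)))).
  rewrite ler_pM2l ?invr_gt0// ler_pM2l//.
  by apply: lerD; [exact: sumD0|exact: sumD].
have -> : tau^-1 * (d * (M1 + M1)) = e by rewrite /d; field; rewrite !gt_eqF.
by [].
Qed.

Lemma lagrangian_small_dist t a b c (d : R) : 0 <= t <= T -> 0 < d ->
  Lag t a b c < (4 * tau)^-1 * d ^+ 2 -> mdist a b < d /\ mdist b c < 2 * d.
Proof.
move=> tT d0 /(le_lt_trans (lagrangian_ge tau0 E_ge a b c tT)).
rewrite ltr_pM2l ?invr_gt0 ?mulr_gt0// => h.
have s1 := sqr_ge0 (mdist a b); have s2 := sqr_ge0 (mdist a b - mdist b c).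
have hab : mdist a b < d.
  rewrite -(@ltr_pXn2r _ 2) ?nnegrE ?mdist_ge0 ?(ltW d0)//; lra.
have habc : `|mdist a b - mdist b c| < d.
  rewrite -(@ltr_pXn2r _ 2) ?nnegrE ?(ltW d0)// real_normK ?num_real//; lra.
by split => //; move: habc; rewrite ltr_norml; lra.
Qed.

(** [K] is relatively clopen in [C]: closed since compact, and cut out by its open r-neighbourhood,
    which misses [Z]. *)
Lemma connected_subset_separated (C K : set X) x (r : R) (Z : set X) :
  connected C -> C x -> K x -> compact K -> 0 < r ->
  (forall y, C y -> K y \/ Z y) ->
  (forall y z, K y -> Z z -> r <= mdist y z) -> C `<=` K.
Proof.
move=> cC Cx Kx cK r0 CKZ sep.
suff <- : C `&` K = C by move=> y [].
apply: cC; first by exists x.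
- exists [set y | exists2 k, K k & mdist k y < r].
    rewrite openE => y [k Kk ky].
    apply/metricType_numDomainType.nbhs_mdistP; exists (r - mdist k y) => /=.
      by rewrite subr_gt0.
    move=> z /= yz; exists k => //; have := metric_triangle k y z; lra.
  apply/seteqP; split => y [Cy].
    by move=> Ky; split => //; exists y => //; rewrite mdistxx.
  move=> [k Kk ky]; split => //; have [//|Zy] := CKZ y Cy.
  by have := sep k y Kk Zy; rewrite leNgt ky.
- exists K => //; apply: compact_closed => //; exact: metric_hausdorff.
Qed.

End Bdf2Components.

Section Bdf2Generated.
Context {R : realType} {X : metricType R}.
Variables (E : R -> X -> R) (T tau K0 C1 L : R).
Hypothesis tau0 : 0 < tau.
Hypothesis E_ge : forall t x, 0 <= t <= T -> 0 <= E t x + K0.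
Hypothesis C10 : 0 < C1.
Hypothesis E_gronwall : forall s t x, 0 <= s <= T -> 0 <= t <= T ->
  E s x + K0 <= (E t x + K0) * expR (C1 * `|s - t|).
Hypothesis rE : regular_energy E T.
Hypothesis csE : compact_sublevels E T.
Hypothesis pX : path_space X.
Hypothesis L0 : 0 < L.
Hypothesis lipE : slope_lipschitz E T L.
Hypothesis tauL : tau <= L^-1.
Hypothesis sepE : separated_critical_sets E T.
Implicit Types (t : R) (x y z : X) (w : nat -> X) (p q : triple X).

Notation Lag t a b c := (bdf2_lagrangian E tau t (mk3 a b c)).
Notation cost := (chain_cost E tau).

(** The two sides differ by d(x, c)^2 / (4 tau). It applies to the first term of a chain, whose
    initial point is doubled. *)
Lemma lagrangian_diag_le t x c : Lag t x x x <= Lag t x x c.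
Proof.
rewrite lagrangian_diag /bdf2_lagrangian /comp_0 /comp_m1 /comp_p1 /=.
have k2 : (2 * tau)^-1 = 2 * (4 * tau)^-1 by field; rewrite gt_eqF.
have : 0 <= (4 * tau)^-1 * mdist x c ^+ 2.
  by rewrite mulr_ge0 ?sqr_ge0// invr_ge0 mulr_ge0// ltW.
rewrite mdistxx expr0n/= k2; lra.
Qed.

(** The first and last terms of every chain bound the diagonal Lagrangians at x1 and x2, which
    therefore vanish with the action. *)
Lemma action_eq0_critical t x1 x2 : 0 <= t <= T ->
  bdf2_action E tau t x1 x2 = 0 -> slope E t x1 = 0%E /\ slope E t x2 = 0%E.
Proof.
move=> tT c0; split; apply: (lagrangian_diag_eq0 tau0 E_ge tT); rewrite -c0;
  apply: bdf2_action_ge => n w [w0 w1 [w2 w3 w4]].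
- apply: le_trans (lagrangian_diag_le t x1 (w 2%N)) _.
  have := lagrangian_le_chain_cost tau0 E_ge tT w (isT : (0 < n.+2)%N).
  by rewrite w0 w1.
- have := lagrangian_le_chain_cost tau0 E_ge tT w (leqnn n.+2).
  by rewrite w2 w3 w4.
Qed.

Lemma first_exit (P : nat -> Prop) n : P 0%N -> ~ P n ->
  exists2 j, (j < n)%N & P j /\ ~ P j.+1.
Proof.
elim: n => [//|n IH] P0 Pn.
have [Pn'|nPn'] := pselect (P n); first by exists n.
by have [j jn hj] := IH P0 nPn'; exists j => //; exact: leqW.
Qed.

(* A chain of vanishing cost has vanishing jumps, so it cannot leave a
   neighbourhood of K1 without accumulating at a critical point outside K1. *)
Lemma action_eq0_same_component t x1 x2 (r : R) (K1 Z : set X) : 0 <= t <= T ->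
  bdf2_action E tau t x1 x2 = 0 -> K1 x1 -> ~ K1 x2 -> 0 < r ->
  (forall y, Crit E t y -> K1 y \/ Z y) ->
  (forall y z, K1 y -> Z z -> r <= mdist y z) -> False.
Proof.
move=> tT c0 K1x1 nK1x2 r0 CKZ sep.
have [cx1 cx2] := action_eq0_critical tT c0.
have Zx2 : Z x2 by have [] := CKZ x2 cx2.
(* A limit within rho of a point that is itself within rho of [K1] stays closer than r to [K1],
   hence cannot lie in [Z]. *)
pose rho := r / 3; have rho0 : 0 < rho by rewrite divr_gt0.
pose near_K1 y := exists2 k, K1 k & mdist k y < rho.
have [KM cKM hKM] := energy_sublevel_compact E_ge C10 E_gronwall csE (E t x2 + 1).
have /choice[f hf] : forall n : nat, exists abc : X * X * X,
    [/\ KM abc.1.2, near_K1 abc.1.2, ~ near_K1 abc.2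
      & Lag t abc.1.1 abc.1.2 abc.2 < harmonic n].
  move=> n; have [m [w [hw]]] := bdf2_action_near E tau t x1 x2 (@harmonic_gt0 R n).
  rewrite c0 add0r => cw; have [w0 w1 [w2 w3 w4]] := hw.
  have [||j jm [nj nj1]] := @first_exit (fun j => near_K1 (w j.+1)) m.
  - by rewrite w1; exists x1 => //; rewrite mdistxx.
  - rewrite w2 => -[k K1k kx2]; have := sep k x2 K1k Zx2.
    move: kx2; rewrite /rho; have := r0; lra.
  have jm2 : (j < m.+2)%N by rewrite (leq_trans jm)// leqW.
  exists (w j, w j.+1, w j.+2); split => //=.
  - apply: (hKM t) => //.
    apply: le_trans (chain_between_energy_le tau0 E_ge tT hw (ltnW jm2)) _.
    rewrite lerD2l; apply: le_trans (ltW cw) _.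
    by rewrite /= invf_le1// ler1n.
  - apply: le_lt_trans cw.
    exact: (lagrangian_le_chain_cost tau0 E_ge tT).
have fK n : KM (f n).1.2 by case: (hf n).
have [y Ky hy] := compact_seq_cluster cKM fK.
have near_y (d : R) : 0 < d -> exists n,
    [/\ Lag t (f n).1.1 (f n).1.2 (f n).2 < d, mdist y (f n).1.2 < d,
      mdist (f n).1.1 (f n).1.2 < d & mdist (f n).1.2 (f n).2 < d].
  move=> d0; have d20 : 0 < d / 2 by rewrite divr_gt0.
  have d'0 : 0 < Num.min d ((4 * tau)^-1 * (d / 2) ^+ 2).
    by rewrite lt_min d0 mulr_gt0 ?invr_gt0 ?mulr_gt0 ?exprn_gt0.
  have [N _ hN] := cvgr0_norm_lt _ (@cvg_harmonic R) _ d'0.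
  have [n Nn yn] := hy d N d0; exists n.
  have [_ _ _ Ln] := hf n.
  have := lt_trans Ln (le_lt_trans (ler_norm _) (hN n Nn)).
  rewrite lt_min => /andP[h1 h2].
  have [h3 h4] := lagrangian_small_dist tau0 E_ge tT d20 h2.
  by split; [exact: h1|exact: yn|lra|lra].
have tri (a b c : X) : mdist a c <= mdist a b + mdist b c := metric_triangle a b c.
have cy : slope E t y = 0%E.
  apply: (lagrangian_diag_eq0 tau0 E_ge tT); apply/ler_addgt0Pr => e e0.
  rewrite add0r; have e20 : 0 < e / 2 by rewrite divr_gt0.
  have [d d0 hd] := lagrangian_near tau0 E_ge C10 E_gronwall rE y y y tT e20.
  have d'0 : 0 < Num.min (d / 2) (e / 2) by rewrite lt_min divr_gt0.
  have [n []] := near_y _ d'0; rewrite !lt_min.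
  move=> /andP[_ h1] /andP[h2 _] /andP[h3 _] /andP[h4 _].
  have ya : mdist y (f n).1.1 < d.
    by have := tri y (f n).1.2 (f n).1.1; rewrite (metric_sym (f n).1.2); lra.
  have yb : mdist y (f n).1.2 < d by lra.
  have yc : mdist y (f n).2 < d by have := tri y (f n).1.2 (f n).2; lra.
  have := hd t _ _ _ tT; rewrite subrr normr0 => /(_ _ _ _ d0 ya yb yc).
  by rewrite ltr_norml; lra.
have K1y : K1 y.
  have [//|Zy] := CKZ y cy; exfalso.
  have [n [_ yb _ _]] := near_y _ rho0.
  have [_ [k K1k kb] _ _] := hf n.
  have := sep k y K1k Zy; have := tri k (f n).1.2 y.
  rewrite (metric_sym (f n).1.2); move: yb kb; rewrite /rho; have := r0; lra.
(* With the limit y in [K1], a late exit point is within two half-radii of y, against its choice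
   outside the neighbourhood. *)
have rho20 : 0 < rho / 2 by rewrite divr_gt0.
have [n [_ yb _ bc]] := near_y _ rho20.
have [_ _ nc _] := hf n; apply: nc; exists y => //.
by have := tri y (f n).1.2 (f n).2; lra.
Qed.

(** Both conditions amount to x1 and x2 lying in the same separated set K. A path in K immerses to a
    connected set of zeros; conversely the middle entry projects a connected set of zeros into a
    single K, where a rectifiable path gives zero action. *)
Lemma bdf2_components t x1 x2 : 0 <= t <= T ->
  bdf2_action E tau t x1 x2 = 0 <->
  connected_component [set p : triple X | bdf2_lagrangian E tau t p = 0]
    (bdf2_immersion x1) (bdf2_immersion x2).
Proof.
move=> tT.
have [[F [CF Fdisj Fcpt Fsep Fpath]] _] := sepE tT.
have inF y : Crit E t y -> exists2 K, F K & K y.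
  by rewrite CF => -[K FK Ky]; exists K.
have split_crit K : F K -> forall y, Crit E t y -> K y \/
    (\bigcup_(K' in [set K' | F K' /\ K' <> K]) K') y.
  move=> FK y /inF[K' FK' K'y].
  have [<-|KK'] := pselect (K' = K); first by left.
  by right; exists K'.
have sep_crit K : F K -> exists2 r : R, 0 < r & forall y z, K y ->
    (\bigcup_(K' in [set K' | F K' /\ K' <> K]) K') z -> r <= mdist y z.
  move=> FK; have [r r0 hr] := Fsep K FK; exists r => // y z Ky [K' [FK' nK] K'z].
  exact: hr FK' nK Ky K'z.
have same_K_path K : F K -> K x1 -> K x2 -> exists2 eta,
    path_in (Crit E t) x1 x2 eta & rectifiable eta.
  move=> FK K1 K2; have [eta [ceta e0 e1 eK] reta] := Fpath K FK x1 x2 K1 K2.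
  exists eta => //; split => // s sI; rewrite CF; exists K => //; exact: eK.
split.
- move=> c0; have [cx1 cx2] := action_eq0_critical tT c0.
  have [K FK Kx1] := inF x1 cx1.
  have [Kx2|nKx2] := pselect (K x2); last first.
    have [r r0 hr] := sep_crit K FK; exfalso.
    exact: (action_eq0_same_component tT c0 Kx1 nKx2 r0 (split_crit K FK) hr).
  have [eta [ceta e0 e1 eC] _] := same_K_path K FK Kx1 Kx2.
  have I0 : `[0, 1]%classic (0 : R) by rewrite /= in_itv/= lexx ler01.
  have I1 : `[0, 1]%classic (1 : R) by rewrite /= in_itv/= lexx ler01.
  exists ((fun s : R => bdf2_immersion (eta s) : triple X) @` `[0, 1]);
    last by exists 1 => //; rewrite e1.
  split.
  + by exists 0 => //; rewrite e0.
  + move=> _ [s sI <-]; apply: (critical_lagrangian_eq0 tau0 E_ge rE pX L0 lipE tauL tT).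
    by apply: eC; move: sI; rewrite /= in_itv.
  + apply: connected_continuous_connected; first exact: segment_connected.
    move=> s; apply: continuous_comp; first exact: ceta.
    exact: bdf2_immersion_continuous.
- move=> [B [Bx1 BC cB] Bx2].
  have sub0 : @comp_0 X @` B `<=` Crit E t.
    move=> _ [p Bp <-].
    have /(lagrangian_eq0 tau0 E_ge rE pX L0 lipE tauL _ tT)[x -> sx] := BC p Bp.
    exact: sx.
  have c0B : connected (@comp_0 X @` B : set X).
    apply: connected_continuous_connected => //.
    by apply: continuous_subspaceT; exact: comp_0_continuous.
  have B1 : (@comp_0 X @` B) x1 by exists (bdf2_immersion x1).
  have B2 : (@comp_0 X @` B) x2 by exists (bdf2_immersion x2).
  have [K FK Kx1] := inF x1 (sub0 _ B1).
  have [r r0 hr] := sep_crit K FK.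
  have BK := connected_subset_separated c0B B1 Kx1 (Fcpt K FK) r0
    (fun y By => split_crit K FK y (sub0 y By)) hr.
  have [eta peta reta] := same_K_path K FK Kx1 (BK _ B2).
  exact: (critical_path_action_eq0 tau0 E_ge rE pX L0 lipE tauL tT peta reta).
Qed.

End Bdf2Generated.

Theorem proposition4p6 (R : realType) (X : metricType R) (T : R)
    (E : R -> X -> R) (L tau : R) (omega : R -> X -> X) :
  0 < T ->
  locally_compact [set: X] ->
  regular_energy E T ->
  power_control E T ->
  compact_sublevels E T ->
  separated_critical_sets E T ->
  path_space X ->
  0 < L -> slope_lipschitz E T L ->
  0 < tau ->
  bdf2_transition_rule E tau T omega ->
  [/\ is_action E T (bdf2_action E tau),
      compatible E T (bdf2_action E tau) omega
    & tau <= L^-1 ->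
      generated_by_curves_on E T (bdf2_action E tau)
        (fun t x1 x2 => x1 <> x2 \/ Crit E t x1)
        (I := Zindex) (P := triple X) bdf2_curves bdf2_immersion
        (bdf2_lagrangian E tau)].
Proof.
move=> T0 _ rE [C1 [C2 [C10 _ pcE]]] csE sepE pX L0 lipE tau0 hom.
have E_ge t x : 0 <= t <= T -> 0 <= E t x + C2 / C1.
  by move=> tT; exact: (energy_shift_ge0 C10 pcE x tT).
have E_gr s t x : 0 <= s <= T -> 0 <= t <= T ->
    E s x + C2 / C1 <= (E t x + C2 / C1) * expR (C1 * `|s - t|).
  by move=> sT tT; exact: (gronwall rE C10 pcE x sT tT).
have act := bdf2_is_action tau0 E_ge C10 E_gr rE.
split; [exact: act|refine (bdf2_compatible tau0 E_ge C10 E_gr rE hom)|].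
move=> tauL; split.
- exact: act.
- exact: bdf2_closed_immersion.
- by move=> t p tT; exact: (lagrangian_ge0 tau0 E_ge).
- exact: (lagrangian_continuous tau0 E_ge C10 E_gr rE).
(* Distinct points use the correspondence of chains and curves; on the diagonal the point is
   critical and both sides are 0. *)
- move=> t x1 x2 tT D.
  have [x12|x12] := pselect (x1 = x2); last first.
    exact: (bdf2_action_eq_action tau0 E_ge tT).
  case: D => [//|cx1]; rewrite -x12; apply: (bdf2_action_diag tau0 E_ge tT).
  exact: (critical_lagrangian_eq0 tau0 E_ge rE pX L0 lipE tauL tT cx1).
- exact: bdf2_admissible_curves.
- by move=> t p tT; exact: (lagrangian_eq0 tau0 E_ge rE pX L0 lipE tauL).
- move=> t x1 x2 tT _.
  exact: (bdf2_components tau0 E_ge C10 E_gr rE csE pX L0 lipE tauL sepE).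
- exact: (bdf2_curves_compactness tau0 E_ge C10 E_gr rE csE (ltW T0)).
- by move=> t tT K e; exact: (bdf2_local_control tau0 E_ge C10 E_gr rE pX L0 lipE tauL).
Qed.
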